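(* Let $A\in\mathbb{C}^{N\times N}$, let $v\in\mathbb{C}^N$ be nonzero with $\beta=\|v\|$, let $\tau>0$, and let $AV_m=V_mH_m+h_{m+1,m}v_{m+1}e_m^T$ be the Arnoldi decomposition of $A$ with starting vector $v$. Let $z_i\in F(A)$, $i\ge0$, be ordered so that equal points are contiguous, let $q_0=1$, $q_k(z)=(z-z_0)\cdots(z-z_{k-1})$ for $k\ge1$, and let $\phi_k(-tH_m)$, $E_m(e^z,t)$ and $E_m^{(2)}(e^z,t)$ be as defined in the context. Let $\mu_2=\mu_2[-A]$. Then $$\|E_m^{(2)}(e^z,\tau)\|\le\gamma_2\,\tau\beta h_{m+1,m}\max_{0\le t\le\tau}\bigl|e_m^T\phi_1(-tH_m)e_1\bigr|,$$ $$\|E_m(e^z,\tau)\|\le(1+\gamma_2)\,\tau\beta h_{m+1,m}\max_{0\le t\le\tau}\bigl|e_m^T\phi_1(-tH_m)e_1\bigr|,$$ where $$\gamma_2=\begin{cases}\|q_1(A)v_{m+1}\|\,\dfrac{e^{\tau\mu_2}-1}{\mu_2}, & \mu_2\ne0,\\[2mm] \tau\,\|q_1(A)v_{m+1}\|, & \mu_2=0.\end{cases}$$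
   Context: $\|\cdot\|$ is the Euclidean vector norm and matrix 2-norm. $F(A)=\{x^*Ax:x^*x=1\}$ is the field of values. The 2-logarithmic norm is $\mu_2[B]=\lim_{h\to0+}\frac{\|I+hB\|-1}{h}=\lambda_{\max}\bigl(\frac{B+B^*}{2}\bigr)$. ''Equal points are contiguous'' means: if $z_i=z_j$ with $i<j$, then $z_i=z_{i+1}=\cdots=z_j$. In the Arnoldi decomposition, the columns of $V_m=[v_1,\ldots,v_m]$ form an orthonormal basis of the Krylov subspace $\mathcal{K}_m(A,v)=\mathrm{span}\{v,Av,\ldots,A^{m-1}v\}$ with $v_1=v/\|v\|$, $v_{m+1}$ is a unit vector orthogonal to the columns of $V_m$, $H_m\in\mathbb{C}^{m\times m}$ is an unreduced upper Hessenberg matrix, $h_{m+1,m}>0$, and $e_j$ is the $j$th coordinate vector of $\mathbb{R}^m$. For each $t\ge0$, the functions $\phi_k$ appearing in $\phi_k(-tH_m)$ are those generated from $f(z)=e^z$ with nodes $-tz_0,-tz_1,\ldots$: $$\phi_0(z)=e^z,\qquad \phi_{k+1}(z)=\frac{\phi_k(z)-\phi_k(-tz_k)}{z+tz_k},\quad k\ge0,$$ with removable singularities filled by continuity (so the $\phi_k$ are entire). In particular $\phi_1(z)=\frac{e^z-e^{-tz_0}}{z+tz_0}$. Define $$E_m(e^z,t)=e^{-tA}v-\beta V_me^{-tH_m}e_1,$$ which has the expansion $E_m(e^z,t)=-t\beta h_{m+1,m}\sum_{k=1}^\infty(-t)^{k-1}\bigl(e_m^T\phi_k(-tH_m)e_1\bigr)q_{k-1}(A)v_{m+1}$,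 and $$E_m^{(2)}(e^z,t)=-t\beta h_{m+1,m}\sum_{k=2}^\infty(-t)^{k-1}\bigl(e_m^T\phi_k(-tH_m)e_1\bigr)q_{k-1}(A)v_{m+1},$$ i.e. $E_m(e^z,t)$ minus its first term $-t\beta h_{m+1,m}\bigl(e_m^T\phi_1(-tH_m)e_1\bigr)v_{m+1}$. *)

(* Defs.v *)
From HB Require Import structures.
From mathcomp Require Import all_boot all_order all_algebra.
From mathcomp Require Import complex.
From mathcomp Require Import all_classical all_reals all_analysis.
Set Implicit Arguments.
Unset Strict Implicit.
Unset Printing Implicit Defensive.
Import Order.TTheory GRing.Theory Num.Theory.
Import numFieldNormedType.Exports.
Local Open Scope classical_set_scope.
Local Open Scope ring_scope.
Local Open Scope complex_scope.
Local Open Scope sesquilinear_scope.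

(* The topology on the complex numbers R[i] is that of their modulus, which the
   library attaches to R[i]^o; limits and derivatives of functions on R[i]
   below are the complex ones. *)

Section Norms.
Variable R : realType.

Definition enorm N (x : 'cV[R[i]]_N) : R :=
  Num.sqrt (\sum_i Normc.normc (x i 0) ^+ 2).

Definition opnorm2 N (B : 'M[R[i]]_N) : R :=
  sup [set enorm (B *m x) | x in [set x : 'cV[R[i]]_N | enorm x = 1]].

Definition lognorm2 N (B : 'M[R[i]]_N) : R :=
  lim ((opnorm2 (1%:M + h%:C *: B) - 1) / h @[h --> 0^'+]).

(* F(A) *)
Definition fov N (A : 'M[R[i]]_N) : set R[i] :=
  [set z | exists x : 'cV[R[i]]_N,
     x ^t* *m x = 1%:M /\ z = (x ^t* *m A *m x) 0 0].

End Norms.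

Section MatrixFunctions.
Variable R : realType.

Definition mxlimn m n (u : nat -> 'M[R[i]]_(m, n)) : 'M[R[i]]_(m, n) :=
  \matrix_(i, j) limn (fun k => u k i j : R[i]^o).

Definition mxseries m n (u : nat -> 'M[R[i]]_(m, n)) : 'M[R[i]]_(m, n) :=
  mxlimn (series u).

Definition cexp (z : R[i]) : R[i] :=
  limn (series (fun n => z ^+ n / n`!%:R : R[i]^o)).

Definition expmx N (X : 'M[R[i]]_N) : 'M[R[i]]_N :=
  mxseries (fun n => n`!%:R^-1 *: X ^+ n).

(* The matrix function f(X), for f entire, through the Taylor series of f
   at 0. *)
Definition entire_mx N (f : R[i] -> R[i]) (X : 'M[R[i]]_N) : 'M[R[i]]_N :=
  mxseries (fun n => (@derive1n _ R[i]^o n f 0 / n`!%:R) *: X ^+ n).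

End MatrixFunctions.

Section Phi.
Variable R : realType.

(* (g w - g a) / (w - a), with its removable singularity at a filled in. *)
Definition divdiff (g : R[i] -> R[i]) (a w : R[i]) : R[i] :=
  if w == a then lim (((g u - g a) / (u - a) : R[i]^o) @[u --> (a : R[i]^o)^'])
  else (g w - g a) / (w - a).

(* phi z t k is the function phi_k generated from exp by the nodes
   - t z_0, - t z_1, ... *)
Fixpoint phi (z : nat -> R[i]) (t : R) (k : nat) : R[i] -> R[i] :=
  if k is k'.+1 then divdiff (phi z t k') (- (t%:C * z k'))
  else @cexp R.

(* e_m^T phi_k(- t H) e_1; the order of H is m.+1, so that the last and first
   coordinates are ord_max and ord0. *)
Definition phi_entry m (H : 'M[R[i]]_m.+1) (z : nat -> R[i]) (t : R)
    (k : nat) : R[i] :=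
  entire_mx (phi z t k) (- (t%:C *: H)) ord_max ord0.

(* q_k(A) = (A - z_0 I) ... (A - z_{k-1} I) *)
Definition q_mx N (A : 'M[R[i]]_N) (z : nat -> R[i]) (k : nat) : 'M[R[i]]_N :=
  \prod_(i < k) (A - (z i)%:M).

Definition contiguous (z : nat -> R[i]) : Prop :=
  forall i j, (i < j)%N -> z i = z j ->
    forall k, (i <= k <= j)%N -> z k = z i.

End Phi.

Section Arnoldi.
Variable R : realType.

Definition krylov N (A : 'M[R[i]]_N) (v : 'cV[R[i]]_N) (m : nat) :
    {vspace 'cV[R[i]]_N} :=
  <<[seq A ^+ j *m v | j <- iota 0 m]>>%VS.

Definition unreduced_hessenberg m (H : 'M[R[i]]_m) : Prop :=
  (forall i j : 'I_m, (j.+1 < i)%N -> H i j = 0) /\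
  (forall i j : 'I_m, i = j.+1 :> nat -> H i j != 0).

(* Arnoldi decomposition with m.+1 steps:
   A V = V H + h w e^T, where e is the last coordinate vector, w stands for the
   next basis vector and h for the entry of the Hessenberg matrix below H. *)
Record arnoldi N m (A : 'M[R[i]]_N) (v : 'cV[R[i]]_N)
    (V : 'M[R[i]]_(N, m.+1)) (H : 'M[R[i]]_m.+1) (h : R) (w : 'cV[R[i]]_N) :
    Prop := Arnoldi {
  arnoldi_ortho : V ^t* *m V = 1%:M;
  arnoldi_basis :
    basis_of (krylov A v m.+1) [seq col j V | j <- enum 'I_m.+1];
  arnoldi_first : col ord0 V = ((enorm v)^-1)%:C *: v;
  arnoldi_next_unit : enorm w = 1;
  arnoldi_next_ortho : V ^t* *m w = 0;
  arnoldi_hessenberg : unreduced_hessenberg H;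
  arnoldi_next_pos : 0 < h;
  arnoldi_rel : A *m V = V *m H + h%:C *: (w *m delta_mx 0 ord_max)
}.

End Arnoldi.

Section Errors.
Variable R : realType.

(* E_m(e^z, t) *)
Definition arnoldi_err N m (A : 'M[R[i]]_N) (v : 'cV[R[i]]_N)
    (V : 'M[R[i]]_(N, m.+1)) (H : 'M[R[i]]_m.+1) (t : R) : 'cV[R[i]]_N :=
  expmx (- (t%:C *: A)) *m v
  - (enorm v)%:C *: (V *m expmx (- (t%:C *: H)) *m delta_mx ord0 0).

(* E_m^{(2)}(e^z, t); the k-th term of the mxseries is the term of index k.+2
   of the expansion of E_m(e^z, t). *)
Definition arnoldi_err2 N m (A : 'M[R[i]]_N) (v : 'cV[R[i]]_N)
    (H : 'M[R[i]]_m.+1) (h : R) (w : 'cV[R[i]]_N) (z : nat -> R[i])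
    (t : R) : 'cV[R[i]]_N :=
  (- (t * enorm v * h))%:C *:
    mxseries (fun k => (((- t) ^+ k.+1)%:C * phi_entry H z t k.+2) *:
                       (q_mx A z k.+1 *m w)).

(* the maximum of |e_m^T phi_1(- t H) e_1| over 0 <= t <= tau; [sup] is that
   maximum, the function being continuous in t *)
Definition max_phi1 m (H : 'M[R[i]]_m.+1) (z : nat -> R[i]) (tau : R) : R :=
  sup [set Normc.normc (phi_entry H z t 1) | t in `[0, tau]].

Definition gamma2 N (A : 'M[R[i]]_N) (w : 'cV[R[i]]_N) (z : nat -> R[i])
    (tau : R) : R :=
  let mu := lognorm2 (- A) in
  if mu == 0 then tau * enorm (q_mx A z 1 *m w)
  else enorm (q_mx A z 1 *m w) * ((expR (tau * mu) - 1) / mu).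

End Errors.

(* Main.v *)
Require Import Defs.
From HB Require Import structures.
From mathcomp Require Import all_boot all_order all_algebra.
From mathcomp Require Import complex.
From mathcomp Require Import all_classical all_reals all_analysis.
From mathcomp Require Import ring lra.
Set Implicit Arguments.
Unset Strict Implicit.
Unset Printing Implicit Defensive.
Import Order.TTheory GRing.Theory Num.Theory.
Import numFieldNormedType.Exports.
Local Open Scope classical_set_scope.
Local Open Scope ring_scope.
Local Open Scope complex_scope.
Local Open Scope sesquilinear_scope.

(* Write E2(t) for the closed form E(t) + t b h phi_1(t) w of the second error,
   where b = |v|, w is the next Arnoldi vector and phi_1(t) stands for
   e_m^T phi_1(-t H) e_1.  The relation A V = V H + h w e_m^T and the identity
   (t phi_1)' = - z_0 t phi_1 + e_m^T e^{-t H} e_1 give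
     E2' = - A E2 + b h t phi_1(t) (A - z_0) w,   E2(0) = 0,
   and Re <x, - A x> <= mu_2 |x|^2, so Gronwall's inequality bounds |E2(tau)|.
   That the series defining the second error sums to E2 is Newton
   interpolation: each phi_k is a power series with coefficients O(C^k / (n + k)!)
   and (X - a_k) phi_{k+1}(X) = phi_k(X) - phi_k(a_k), so that n steps leave a
   remainder (-t)^n q_n(A) D_n, which is O(C^n / n!). *)

(** The nodes [- t z_k] move with t and [divdiff] takes a limit at its node, so [phi] is never
    differentiated in t directly. Functions are handled through their coefficients: a divided
    difference acts on them by [ddcoef], one formula for distinct and confluent nodes, and the
    pairing [csum c x] serves numbers (x_n = w^n) and matrix entries (x_n = (X^n)_{ij}) alike. The
    dependence on t is encoded a second time, by exponential generating functions sum x_n t^n / n!,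
    for which d/dt is the shift of x. The entries of exp(-t A) and exp(-t H) have this form at once;
    t phi_1 has it because sum_i d_i x_i, with d the divided differences of c, rearranges into sum_n
    c_{n+1} h_{n+1}, with h a Horner sequence. The differential equation of E2 thus becomes a
    one-step recurrence between coefficient vectors. *)

Local Notation normc := Normc.normc.
Local Notation Re := complex.Re.
Local Notation Im := complex.Im.

(** * Limits and series of complex numbers *)

Section ComplexLimits.
Context {R : realType}.
Local Notation C := R[i].
Local Notation Co := (R[i]^o).
Implicit Types (x y : C) (u : nat -> C).

Lemma normc_normr x : (normc x)%:C = `|x|.
Proof. by case: x. Qed.

Lemma normc_ge0 x : 0 <= normc x.
Proof. by case: x => a b; exact: sqrtr_ge0. Qed.

Lemma normcD x y : normc (x + y) <= normc x + normc y.
Proof. exact: le_normcD. Qed.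

Lemma normcB x y : normc (x - y) = normc (y - x).
Proof. by rewrite -normcN opprB. Qed.

Lemma normcX x n : normc (x ^+ n) = normc x ^+ n.
Proof.
elim: n => [|n IH]; first by rewrite !expr0 Normc.normc1.
by rewrite !exprS Normc.normcM IH.
Qed.

Lemma normc_real (r : R) : normc r%:C = `|r|.
Proof. by rewrite /normc /= expr0n /= addr0 sqrtr_sqr. Qed.

Lemma normc_nat n : normc (n%:R : C) = n%:R.
Proof. by rewrite -[n%:R](rmorph_nat (real_complex R)) normc_real ger0_norm. Qed.

Lemma normc_sum (I : Type) (r : seq I) (P : pred I) (F : I -> C) :
  normc (\sum_(i <- r | P i) F i) <= \sum_(i <- r | P i) normc (F i).
Proof.
elim/big_ind2: _ => //; first by rewrite Normc.normc0.
by move=> a b c d h1 h2; apply: le_trans (normcD _ _) _; exact: lerD.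
Qed.

Lemma normc_Re x : `|Re x| <= normc x.
Proof. by rewrite -lecR (le_trans (normc_ge_Re x))// -normc_normr. Qed.

Lemma normc_Im x : `|Im x| <= normc x.
Proof.
case: x => a b /=; rewrite -sqrtr_sqr ler_sqrt ?lerDr ?addr_ge0 ?sqr_ge0//.
Qed.

Lemma normc_ReIm x : normc x <= `|Re x| + `|Im x|.
Proof.
case: x => a b /=.
have h : 0 <= `|a| + `|b| by rewrite addr_ge0.
rewrite -[leRHS]ger0_norm// -sqrtr_sqr ler_sqrt ?sqr_ge0//.
rewrite sqrrD !real_normK ?num_real// -addrA lerD2l lerDr.
by rewrite mulrn_wge0 ?mulr_ge0.
Qed.

Lemma ReD x y : Re (x + y) = Re x + Re y. Proof. by case: x y => [? ?] []. Qed.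
Lemma ImD x y : Im (x + y) = Im x + Im y. Proof. by case: x y => [? ?] []. Qed.
Lemma ReB x y : Re (x - y) = Re x - Re y. Proof. by case: x y => [? ?] []. Qed.
Lemma ImB x y : Im (x - y) = Im x - Im y. Proof. by case: x y => [? ?] []. Qed.

(** Neighbourhoods in [R[i]^o] are measured by complex e > 0. Such an e is real, so the limit
    reduces to a real one, where squeezing applies. *)
Lemma cvg_normcP {T : Type} {F : set_system T} {FF : Filter F}
    (f : T -> Co) (l : Co) :
  (fun t => normc (f t - l)) @ F --> 0 <-> f @ F --> l.
Proof.
have E t : `|l - f t| = (normc (f t - l))%:C.
  by rewrite normc_normr; exact: (@distrC C C).
split=> [/cvgrPdist_lt h|/cvgrPdist_lt h]; apply/cvgrPdist_lt => e e0.
- have e0' : 0 < Re e by move: e0; rewrite ltcE /= => /andP[].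
  have ee : e = (Re e)%:C by rewrite RRe_real// gtr0_real.
  move: (h _ e0'); apply: filterS => t.
  rewrite sub0r normrN ger0_norm ?normc_ge0// -ltcR -ee => flt.
  exact: (eq_ind_r (fun z : C => z < e) flt (E t)).
- have e0' : (0 : C) < e%:C by rewrite ltcR.
  move: (h _ e0'); apply: filterS => t.
  move=> flt; rewrite sub0r normrN ger0_norm ?normc_ge0// -ltcR.
  exact: (eq_ind (`|l - f t| : C) (fun z : C => z < e%:C) flt _ (E t)).
Qed.

Lemma cvg_ReIm {T : Type} {F : set_system T} {FF : Filter F}
    (f : T -> Co) (a b : R) :
  (fun t => Re (f t)) @ F --> a -> (fun t => Im (f t)) @ F --> b ->
  f @ F --> (a +i* b : Co).
Proof.
move=> fa fb; apply/cvg_normcP.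
have fab : (fun t => `|Re (f t) - a| + `|Im (f t) - b|) @ F --> (0 : R).
  rewrite -[0]addr0; apply: cvgD; apply/cvgr0Pnorm_lt => e e0.
    move/cvgrPdist_lt : fa => /(_ _ e0); apply: filterS => t.
    by rewrite normr_id distrC.
  move/cvgrPdist_lt : fb => /(_ _ e0); apply: filterS => t.
  by rewrite normr_id distrC.
apply: (squeeze_cvgr _ (cvg_cst 0) fab).
apply: nearW => t; rewrite normc_ge0 /=.
by apply: le_trans (normc_ReIm _) _; case: (f t).
Qed.

Lemma cvg_Re {T : Type} {F : set_system T} {FF : Filter F}
    (f : T -> Co) (l : Co) :
  f @ F --> l -> (fun t => Re (f t)) @ F --> Re l.
Proof.
move=> /cvg_normcP/cvgrPdist_lt h; apply/cvgrPdist_lt => e /h.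
apply: filterS => t; rewrite sub0r normrN ger0_norm ?normc_ge0//.
apply: le_lt_trans; rewrite distrC.
by rewrite -ReB; exact: normc_Re.
Qed.

Lemma cvg_Im {T : Type} {F : set_system T} {FF : Filter F}
    (f : T -> Co) (l : Co) :
  f @ F --> l -> (fun t => Im (f t)) @ F --> Im l.
Proof.
move=> /cvg_normcP/cvgrPdist_lt h; apply/cvgrPdist_lt => e /h.
apply: filterS => t; rewrite sub0r normrN ger0_norm ?normc_ge0//.
apply: le_lt_trans; rewrite distrC.
by rewrite -ImB; exact: normc_Im.
Qed.

Lemma Re_sum (I : Type) (r : seq I) (P : pred I) (F : I -> C) :
  Re (\sum_(i <- r | P i) F i) = \sum_(i <- r | P i) Re (F i).
Proof. by apply: (big_morph _ ReD). Qed.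

Lemma Im_sum (I : Type) (r : seq I) (P : pred I) (F : I -> C) :
  Im (\sum_(i <- r | P i) F i) = \sum_(i <- r | P i) Im (F i).
Proof. by apply: (big_morph _ ImD). Qed.

Lemma cvg_limnC (u : nat -> Co) (l : Co) : u @ \oo --> l -> limn u = l.
Proof. by move=> /cvg_lim; apply; exact: norm_hausdorff. Qed.

Lemma eq_limnC (u v : nat -> Co) : u =1 v -> limn u = limn v.
Proof. by move=> /funext ->. Qed.

Lemma is_cvg_dominated_series (u : nat -> Co) (b : nat -> R) :
  (forall n, normc (u n) <= b n) -> cvgn (series b) -> cvgn (series u).
Proof.
move=> ub cb.
have b0 n : 0 <= b n by apply: le_trans (ub n); exact: normc_ge0.
have cR : cvgn (series (fun n => Re (u n))).
  apply: normed_cvg; apply: (series_le_cvg _ b0 _ cb) => n //=.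
  exact: le_trans (normc_Re _) (ub n).
have cI : cvgn (series (fun n => Im (u n))).
  apply: normed_cvg; apply: (series_le_cvg _ b0 _ cb) => n //=.
  exact: le_trans (normc_Im _) (ub n).
apply/cvg_ex; exists (limn (series (fun n => Re (u n))) +i*
                      limn (series (fun n => Im (u n)))).
apply: cvg_ReIm.
  rewrite (_ : (fun t => _) = series (fun n => Re (u n)))//.
  by apply/funext => n; rewrite /series/= Re_sum.
rewrite (_ : (fun t => _) = series (fun n => Im (u n)))//.
by apply/funext => n; rewrite /series/= Im_sum.
Qed.

Lemma normc_lim_le (u : nat -> Co) (l : Co) (B : R) :
  u @ \oo --> l -> (forall n, normc (u n) <= B) -> normc l <= B.
Proof.
move=> /cvg_normcP ul uB; apply/ler_addgt0Pr => e e0.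
have /cvgrPdist_lt/(_ _ e0)[n _ /(_ n (leqnn n))] := ul.
rewrite sub0r normrN ger0_norm ?normc_ge0// => /ltW h.
by rewrite -(subrK (u n) l) addrC (le_trans (normcD _ _))// lerD// normcB.
Qed.

Lemma normc_series_le (u : nat -> Co) (b : nat -> R) (B : R) :
  (forall n, normc (u n) <= b n) -> series b @ \oo --> B ->
  normc (limn (series u)) <= B.
Proof.
move=> ub cb; have b0 n : 0 <= b n by apply: le_trans (ub n); exact: normc_ge0.
have cu := is_cvg_dominated_series ub (cvgP _ cb).
apply: (normc_lim_le cu) => n.
apply: le_trans (normc_sum _ _ _) _.
apply: (@le_trans _ _ (series b n)); first exact: ler_sum.
have nd : nondecreasing_seq (series b).
  by apply/nondecreasing_seqP => k; rewrite /series/= big_nat_recr//= lerDl.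
by rewrite -(cvg_lim _ cb)//; exact: (nondecreasing_cvgn_le nd (cvgP _ cb)).
Qed.

Lemma cvg_exp_series (K r : R) :
  series (fun n => K * (r ^+ n / n`!%:R)) @ \oo --> K * expR r.
Proof.
rewrite (_ : series _ = fun n => K * series (exp_coeff r) n); last first.
  by apply/funext => n; rewrite /series/= mulr_sumr.
by apply: cvgM; [exact: cvg_cst|exact: is_cvg_series_exp_coeff].
Qed.

Lemma cvg0_exp_bound (u : nat -> Co) (K r : R) :
  (forall n, normc (u n) <= K * (r ^+ n / n`!%:R)) -> u @ \oo --> (0 : Co).
Proof.
move=> h; apply/cvg_normcP.
have c : (fun n => K * exp_coeff r n) @ \oo --> 0.
  by rewrite -(mulr0 K); apply: cvgM; [exact: cvg_cst|exact: cvg_exp_coeff].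
apply: (squeeze_cvgr _ (cvg_cst 0) c).
by apply: nearW => n; rewrite subr0 normc_ge0 /=.
Qed.

End ComplexLimits.

(** * Power series with factorially decaying coefficients *)

Section Quotients.
Context {K : numFieldType}.
Implicit Types (f g : K^o -> K^o) (a : K^o).

Lemma cvg_dnbhs_eq f g a :
  (forall w, w != a -> f w = g w) -> {for a, continuous g} ->
  f w @[w --> a^'] --> g a.
Proof.
move=> fg ga.
have h : g w @[w --> a^'] --> g a by exact: cvg_within_filter ga.
apply: cvg_trans h; apply: near_eq_cvg.
by near=> w; apply/esym/fg; near: w; exact: nbhs_dnbhs_neq.
Unshelve. all: by end_near. Qed.

Lemma lim_quotient f g a :
  (forall w, f w - f a = (w - a) * g w) -> {for a, continuous g} ->
  lim (((f w - f a) / (w - a) : K^o) @[w --> a^']) = g a.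
Proof.
move=> fg gc; apply: cvg_lim; first exact: norm_hausdorff.
apply: cvg_dnbhs_eq gc => w wa.
by rewrite fg mulrAC mulfV ?mul1r// subr_eq0.
Qed.

Lemma derive1_quotient f g a :
  (forall w, f w - f a = (w - a) * g w) -> {for a, continuous g} ->
  derive1 f a = g a.
Proof.
move=> fg; rewrite continuous_shift => gc.
apply: cvg_lim; first exact: norm_hausdorff.
have -> : g a = (g \o shift a) 0 by rewrite /= add0r.
apply: cvg_dnbhs_eq gc => h h0 /=.
by rewrite fg addrK /GRing.scale/= mulrA mulVf ?mul1r.
Qed.

End Quotients.

(** * Divided differences and derivatives on coefficient sequences *)

Section CoefficientSequences.
Context {R : realType}.
Local Notation C := R[i].
Local Notation Co := (R[i]^o).
Implicit Types (c x : nat -> C) (a w : C).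

(** A pairing rather than a power series, so that values at numbers and entries of matrix functions
    share the same lemmas. *)
Definition csum c x : C := limn (series (fun n => c n * x n : Co)).

Definition powser c w : C := csum c (GRing.exp w).

(** By w^n - a^n = (w - a) sum_{i+j=n-1} w^i a^j, these are the coefficients of (g w - g a) / (w -
    a) when g has coefficients [c]. *)
Definition ddcoef c a (i : nat) : C :=
  limn (series (fun j => c (i + j).+1 * a ^+ j : Co)).

Definition dcoef c (n : nat) : C := n.+1%:R * c n.+1.

(** In closed form, sum_{i<n} a^(n-1-i) x_i. For x_i = w^i this is (w^n - a^n) / (w - a), or n
    w^(n-1) when a = w. *)
Fixpoint horner_seq a x n : C :=
  if n is n'.+1 then a * horner_seq a x n' + x n' else 0.

(** The offset [k] counts the divided differences already taken: each improves the decay by one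
    factorial step. *)
Definition fact_le c (K : R) (k : nat) :=
  forall n, normc (c n) <= K / (n + k)`!%:R.

Definition geom_le x (P r : R) := forall n, normc (x n) <= P * r ^+ n.

Lemma eq_csum c x c' x' :
  (forall n, c n * x n = c' n * x' n) -> csum c x = csum c' x'.
Proof. by move=> e; rewrite /csum (funext (fun n => e n)). Qed.

Lemma fact_le_ge0 c K k : fact_le c K k -> 0 <= K.
Proof.
move=> /(_ 0%N) h; have := le_trans (normc_ge0 _) h.
by rewrite pmulr_lge0// invr_gt0 ltr0n fact_gt0.
Qed.

Lemma geom_le_ge0 x P r : geom_le x P r -> 0 <= P.
Proof.
move=> /(_ 0%N) h; have := le_trans (normc_ge0 _) h.
by rewrite expr0 mulr1.
Qed.

Lemma geom_exp w : geom_le (GRing.exp w) 1 (normc w).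
Proof. by move=> n; rewrite normcX mul1r. Qed.

Lemma invf_factD_le (n k : nat) :
  ((n + k)`!%:R : R)^-1 <= (k`!%:R)^-1 * (n`!%:R)^-1.
Proof.
rewrite -invfM -natrM lef_pV2 ?posrE ?ltr0n ?muln_gt0 ?fact_gt0// ler_nat.
rewrite -(@bin_fact (n + k) k) ?leq_addl// addnK leq_pmull//.
by rewrite bin_gt0 leq_addl.
Qed.

Lemma fact_leW c K k : fact_le c K k -> fact_le c (K / k`!%:R) 0.
Proof.
move=> h n; rewrite addn0; apply: le_trans (h n) _; rewrite -mulrA.
by apply: ler_wpM2l; [exact: fact_le_ge0 h|exact: invf_factD_le].
Qed.

Lemma csum_term_le c x K P r n : fact_le c K 0 -> geom_le x P r ->
  normc (c n * x n) <= K * P * (r ^+ n / n`!%:R).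
Proof.
move=> ck xr; rewrite Normc.normcM.
apply: (@le_trans _ _ (K / n`!%:R * (P * r ^+ n))).
  by apply: ler_pM; rewrite ?normc_ge0//; have := ck n; rewrite addn0.
rewrite le_eqVlt; apply/orP; left; apply/eqP; ring.
Qed.

Lemma cvg_csum c x K P r : fact_le c K 0 -> geom_le x P r ->
  series (fun n => c n * x n : Co) @ \oo --> (csum c x : Co).
Proof.
move=> ck xr.
apply: (is_cvg_dominated_series (b := fun n => K * P * (r ^+ n / n`!%:R))).
  by move=> n; exact: csum_term_le.
by apply: cvgP; exact: cvg_exp_series.
Qed.

Lemma csum_le c x K P r : fact_le c K 0 -> geom_le x P r ->
  normc (csum c x) <= K * P * expR r.
Proof.
move=> ck xr.
apply: (@normc_series_le _ (fun n => c n * x n)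
  (fun n => K * P * (r ^+ n / n`!%:R))); last exact: cvg_exp_series.
by move=> n; exact: csum_term_le.
Qed.

(** The factorial is split by (p + q)! >= p! q!: the part 1/j! makes the sum over j at most e^|a|,
    the part 1/(i+k+1)! keeps the decay in i. *)
Lemma ddcoef_term_le c K k a i j : fact_le c K k ->
  normc (c (i + j).+1 * a ^+ j)
    <= K / (i + k.+1)`!%:R * (normc a ^+ j / j`!%:R).
Proof.
move=> ck; rewrite Normc.normcM normcX.
apply: (@le_trans _ _ (K / (j + (i + k.+1))`!%:R * normc a ^+ j)).
  apply: ler_wpM2r; first by rewrite exprn_ge0 ?normc_ge0.
  by rewrite (_ : (j + _)%N = ((i + j).+1 + k)%N)// addnS -addSn addnA (addnC j).
rewrite mulrAC -[leRHS]mulrA; rewrite -mulrA.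
apply: ler_wpM2l; first exact: fact_le_ge0 ck.
rewrite mulrC (mulrC (normc a ^+ j)) mulrA.
apply: ler_wpM2r; first by rewrite exprn_ge0 ?normc_ge0.
exact: invf_factD_le.
Qed.

Lemma cvg_ddcoef c K k a i : fact_le c K k ->
  series (fun j => c (i + j).+1 * a ^+ j : Co) @ \oo --> (ddcoef c a i : Co).
Proof.
move=> ck; apply: is_cvg_dominated_series.
  by move=> j; exact: (ddcoef_term_le _ _ _ ck).
by apply: cvgP; exact: cvg_exp_series.
Qed.

Lemma fact_le_ddcoef c K k a : fact_le c K k ->
  fact_le (ddcoef c a) (K * expR (normc a)) k.+1.
Proof.
move=> ck i; rewrite mulrAC.
apply: normc_series_le; last exact: cvg_exp_series.
by move=> j; exact: ddcoef_term_le.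
Qed.

Lemma ddcoefS c K k a i : fact_le c K k ->
  ddcoef c a i = c i.+1 + a * ddcoef c a i.+1.
Proof.
move=> ck; apply: cvg_limnC; rewrite -cvg_shiftS /=.
rewrite (_ : (fun n => _) = (fun n => c i.+1 + a *
    series (fun j => c (i.+1 + j).+1 * a ^+ j) n)).
  by apply: cvgD; [exact: cvg_cst|apply: cvgM; [exact: cvg_cst|]];
    exact: cvg_ddcoef ck.
apply/funext => n; rewrite /series/= big_nat_recl//= addn0 expr0 mulr1.
congr (_ + _); rewrite mulr_sumr; apply: eq_bigr => j _.
by rewrite addnS exprS addSn; ring.
Qed.

Lemma powser_node c K k a : fact_le c K k ->
  powser c a = c 0%N + a * ddcoef c a 0.
Proof.
move=> ck; apply: cvg_limnC; rewrite -cvg_shiftS /=.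
rewrite (_ : (fun n => _) = (fun n => c 0%N + a *
    series (fun j => c (0 + j).+1 * a ^+ j) n)).
  by apply: cvgD; [exact: cvg_cst|apply: cvgM; [exact: cvg_cst|]];
    exact: cvg_ddcoef ck.
apply/funext => n; rewrite /series/= big_nat_recl//= expr0 mulr1.
congr (_ + _); rewrite mulr_sumr; apply: eq_bigr => j _.
by rewrite exprS add0n; ring.
Qed.

Lemma geom_leS x P r : geom_le x P r -> geom_le (fun n => x n.+1) (P * r) r.
Proof. by move=> xr n; rewrite -mulrA -exprS. Qed.

(** With d the divided differences, c_0 = g(a) - a d_0 and c_{n+1} = d_n - a d_{n+1}. The shift of
    [x] stands for multiplication by the argument, so this is g(X) = g(a) + (X - a) d(X) in a form
    that also applies to matrix entries. *)
Lemma csum_ddcoef c K k a x P r : fact_le c K k -> geom_le x P r ->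
  csum c x = powser c a * x 0%N
             + (csum (ddcoef c a) (fun n => x n.+1) - a * csum (ddcoef c a) x).
Proof.
move=> ck xr; have dk := fact_leW (fact_le_ddcoef a ck).
apply: cvg_limnC; rewrite -cvg_shiftS /=.
set d := ddcoef c a.
(* The identity is exact at finite level: against n + 1 terms on the left stand n shifted and n + 1
   unshifted terms on the right. *)
rewrite (_ : (fun n => _) = (fun n => powser c a * x 0%N +
    (series (fun n => d n * x n.+1 : Co) n
     - a * series (fun n => d n * x n : Co) n.+1))).
  apply: cvgD; first exact: cvg_cst.
  apply: cvgB; first exact: (cvg_csum dk (geom_leS xr)).
  apply: cvgM; first exact: cvg_cst.
  by rewrite cvg_shiftS; exact: (cvg_csum dk xr).
apply/funext; elim=> [|n IH].
  rewrite /series/= !big_nat_recr//= !big_geq// (powser_node _ ck) -/d; ring.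
rewrite [LHS]big_nat_recr//= -[X in X + _]/(series _ _) IH.
rewrite [series _ n.+2]/series/= big_nat_recr//=.
rewrite [series _ n.+1 in RHS]/series/= [in RHS]big_nat_recr//=.
have := ddcoefS a n ck; rewrite -/d => ->.
rewrite /series/=; ring.
Qed.

(** Summation by parts with c_{n+1} = d_n - a d_{n+1} and h_{n+1} = a h_n + x_n; only the boundary
    term survives. *)
Lemma horner_seq_sub c K k a x n : fact_le c K k ->
  \sum_(0 <= i < n) ddcoef c a i * x i
  - \sum_(0 <= i < n) c i.+1 * horner_seq a x i.+1
  = a * ddcoef c a n * horner_seq a x n.
Proof.
move=> ck; elim: n => [|n IH]; first by rewrite !big_geq// subrr mulr0.
rewrite !big_nat_recr//= opprD addrACA IH.
have -> : c n.+1 = ddcoef c a n - a * ddcoef c a n.+1.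
  by rewrite (ddcoefS a n ck) addrK.
ring.
Qed.

(** The ratio s must dominate r, so that |x_n| <= P s^n, and |a| + 1, so that |a| P s^n + P s^n <= P
    s^(n+1). *)
Lemma geom_le_horner_seq a x P r : 0 <= r -> geom_le x P r ->
  geom_le (horner_seq a x) P (r + normc a + 1).
Proof.
move=> r0 xr; have P0 := geom_le_ge0 xr.
have a0 := normc_ge0 a; set s := r + normc a + 1.
have s0 : 0 <= s by rewrite !addr_ge0.
elim=> [|n IH].
  by rewrite (_ : horner_seq a x 0 = 0)// Normc.normc0 expr0 mulr1.
rewrite (_ : horner_seq a x n.+1 = a * horner_seq a x n + x n)//.
rewrite (le_trans (normcD _ _))// Normc.normcM.
apply: (@le_trans _ _ (normc a * (P * s ^+ n) + P * s ^+ n)).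
  apply: lerD; first exact: ler_wpM2l.
  apply: le_trans (xr n) _; apply: ler_wpM2l => //.
  by apply: lerXn2r => //; rewrite ?nnegrE// /s -addrA lerDl addr_ge0.
rewrite exprS -[X in _ + X]mul1r -mulrDl mulrCA ler_wpM2l//.
rewrite ler_wpM2r ?exprn_ge0// /s; lra.
Qed.

(* The two series differ, after n terms, by a * d_n * h_n, with d the divided
   differences and h the Horner sequence. *)
Lemma csum_ddcoef_rearrange c K k a x P r : 0 <= r ->
  fact_le c K k -> geom_le x P r ->
  csum (ddcoef c a) x = csum (fun n => c n.+1) (fun n => horner_seq a x n.+1).
Proof.
move=> r0 ck xr; have dk := fact_leW (fact_le_ddcoef a ck).
apply/esym/cvg_limnC.
set s := series _; rewrite (_ : s = (fun n =>
  series (fun n => ddcoef c a n * x n) n - a * ddcoef c a n * horner_seq a x n)).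
  rewrite -[X in _ --> X]subr0; apply: cvgB; first exact: (cvg_csum dk xr).
  apply: (@cvg0_exp_bound _ _ (normc a * (K * expR (normc a) / k.+1`!%:R * P))
    (r + normc a + 1)) => n.
  rewrite -mulrA Normc.normcM -[leRHS]mulrA ler_wpM2l ?normc_ge0//.
  exact: csum_term_le dk (geom_le_horner_seq a r0 xr).
apply/funext => n; rewrite -(horner_seq_sub a x n ck) /series/=.
by rewrite opprB addrC subrK.
Qed.

Lemma powser_sub c K k a w : fact_le c K k ->
  powser c w - powser c a = (w - a) * powser (ddcoef c a) w.
Proof.
move=> ck; have gw := geom_exp w.
have dk := fact_leW (fact_le_ddcoef a ck).
have -> : powser c w = powser c a * w ^+ 0 + (w * powser (ddcoef c a) w
    - a * powser (ddcoef c a) w).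
  rewrite {1}/powser (csum_ddcoef a ck gw); congr (_ + (_ - _)).
  apply: cvg_limnC.
  rewrite (_ : series _ = fun n => w * series (fun n => ddcoef c a n * w ^+ n) n).
    by apply: cvgM; [exact: cvg_cst|exact: cvg_csum dk gw].
  apply/funext => n; rewrite /series/= mulr_sumr; apply: eq_bigr => i _.
  by rewrite exprS mulrCA.
rewrite expr0 mulr1; move: (powser c a) (powser _ w) => p q; ring.
Qed.

Lemma powser_le c K w : fact_le c K 0 -> normc (powser c w) <= K * expR (normc w).
Proof. by move=> ck; have := csum_le ck (geom_exp w); rewrite mulr1. Qed.

(** The factorization [powser_sub] gives a Lipschitz estimate on |w - a| < 1, where the quotient
    series is at most K' e^(|a|+1). *)
Lemma continuous_powser c K k (a : Co) : fact_le c K k ->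
  {for a, continuous (powser c : Co -> Co)}.
Proof.
move=> ck.
apply: (cvg_normcP (F := nbhs (a : Co)) (powser c : Co -> Co) (powser c a)).1.
have dk := fact_leW (fact_le_ddcoef a ck).
set K' := _ / _ in dk; have K0 := fact_le_ge0 dk.
have ca : (fun w : Co => normc (w - a)) @ (a : Co) --> (0 : R).
  by apply: (cvg_normcP (F := nbhs (a : Co)) (fun w => w) a).2; exact: cvg_id.
have c1 : (fun w : Co => normc (w - a) * (K' * expR (normc a + 1))) @ (a : Co)
    --> (0 : R).
  by rewrite -(mul0r (K' * expR (normc a + 1))); exact: (cvgM ca (cvg_cst _)).
apply: (squeeze_cvgr _ (cvg_cst 0) c1).
have /cvgrPdist_lt/(_ _ ltr01) := ca; apply: filterS => w.
rewrite sub0r normrN ger0_norm ?normc_ge0// => wa.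
rewrite /= (powser_sub a w ck) Normc.normcM ler_wpM2l ?normc_ge0//.
apply: le_trans (powser_le _ dk) _; rewrite ler_wpM2l// ler_expR.
by rewrite -(subrK a w) (le_trans (normcD _ _))// addrC lerD2l ltW.
Qed.

Lemma divdiff_powser c K k a : fact_le c K k ->
  divdiff (powser c) a = powser (ddcoef c a).
Proof.
move=> ck; have dk := fact_le_ddcoef a ck.
apply/funext => w; rewrite /divdiff; case: eqVneq => [->|wa].
  exact: (@lim_quotient C (powser c) (powser (ddcoef c a)) a
    (fun u => powser_sub a u ck) (continuous_powser dk)).
rewrite (powser_sub a w ck) mulrAC mulfV ?mul1r// subr_eq0//.
Qed.

Lemma horner_seq_exp w n : horner_seq w (GRing.exp w) n.+1 = n.+1%:R * w ^+ n.
Proof.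
elim: n => [|n IH]; first by rewrite /= mulr0 add0r mul1r.
rewrite (_ : horner_seq w (GRing.exp w) n.+2 =
   w * horner_seq w (GRing.exp w) n.+1 + w ^+ n.+1)// IH exprS -[n.+2%:R]natr1.
ring.
Qed.

(** On the diagonal the Horner sequence of the powers of w is (n+1) w^n, so differentiation of the
    series term by term follows from a rearrangement. *)
Lemma powser_ddcoef_diag c K k w : fact_le c K k ->
  powser (ddcoef c w) w = powser (dcoef c) w.
Proof.
move=> ck; have w0 := normc_ge0 w.
rewrite /powser (csum_ddcoef_rearrange _ w0 ck (geom_exp w)).
apply: eq_csum => n.
by rewrite horner_seq_exp /dcoef; ring.
Qed.

Lemma fact_le_dcoef c K : fact_le c K 0 -> fact_le (dcoef c) K 0.
Proof.
move=> ck n; rewrite /dcoef Normc.normcM normc_nat.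
have := ck n.+1; rewrite !addn0 factS natrM invfM => h.
apply: le_trans (ler_wpM2l _ h) _ => //.
by rewrite mulrCA mulVKf// mulrCA.
Qed.

Lemma derive1_powser c K : fact_le c K 0 ->
  @derive1 _ Co (powser c : Co -> Co) = powser (dcoef c).
Proof.
move=> ck; apply/funext => w; rewrite -(powser_ddcoef_diag w ck).
have dk := fact_le_ddcoef w ck.
exact: (@derive1_quotient C (powser c) (powser (ddcoef c w)) w
  (fun u => powser_sub w u ck) (continuous_powser dk)).
Qed.

Lemma derive1n_powser c K n : fact_le c K 0 ->
  @derive1n _ Co n (powser c : Co -> Co) = powser (iter n dcoef c).
Proof.
move=> ck; rewrite /derive1n.
suff : fact_le (iter n dcoef c) K 0 /\
  iter n (@derive1 _ Co) (powser c : Co -> Co) = powser (iter n dcoef c).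
  by case.
elim: n => [//|n [IH1 IH2]]; split; first by rewrite iterS; exact: fact_le_dcoef.
by rewrite !iterS IH2 (derive1_powser IH1).
Qed.

Lemma iter_dcoef c n i : iter n dcoef c i * i`!%:R = (n + i)`!%:R * c (n + i)%N.
Proof.
elim: n i => [|n IH] i; first by rewrite mulrC.
rewrite iterS /dcoef mulrAC -natrM -factS mulrC IH addSnnS//.
Qed.

Lemma derive1n_powser0 c K n : fact_le c K 0 ->
  @derive1n _ Co n (powser c : Co -> Co) 0 / n`!%:R = c n.
Proof.
move=> ck; rewrite (derive1n_powser n ck).
have := iter_dcoef c n 0; rewrite addn0 mulr1 => E.
have csum0 c' K' : fact_le c' K' 0 -> powser c' 0 = c' 0%N.
  by move=> ck'; rewrite (powser_node 0 ck') mul0r addr0.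
have [K' ck'] : exists K', fact_le (iter n dcoef c) K' 0.
  exists K; elim: {E} n => [//|n IH]; rewrite iterS; exact: fact_le_dcoef.
by rewrite (csum0 _ _ ck') E mulrAC mulfV ?mul1r// pnatr_eq0 -lt0n fact_gt0.
Qed.
End CoefficientSequences.

(** * Power series of matrices *)

Lemma cvg_sum (K : numFieldType) (V : normedModType K) (T I : Type)
    (F : set_system T) (r : seq I) (f : I -> T -> V) (a : I -> V) : Filter F ->
  (forall i, f i @ F --> a i) ->
  (fun t => \sum_(i <- r) f i t) @ F --> \sum_(i <- r) a i.
Proof.
move=> FF fa; elim: r => [|i r IH].
  by under eq_fun do rewrite big_nil; rewrite big_nil; exact: cvg_cst.
by under eq_fun do rewrite big_cons; rewrite big_cons; exact: cvgD.
Qed.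

Section MatrixPowerSeries.
Context {R : realType}.
Local Notation C := R[i].
Local Notation Co := (R[i]^o).
Implicit Types (c x : nat -> C) (a w : C).

(** Submultiplicative and above the modulus of every entry, hence suited to the entrywise limits
    that define [mxseries]. *)
Definition smx m n (X : 'M[C]_(m, n)) : R := \sum_i \sum_j normc (X i j).

Lemma smx_ge0 m n (X : 'M[C]_(m, n)) : 0 <= smx X.
Proof. by do 2 apply: sumr_ge0 => ? _; exact: normc_ge0. Qed.

Lemma normc_le_smx m n (X : 'M[C]_(m, n)) i j : normc (X i j) <= smx X.
Proof.
rewrite /smx (bigD1 i)//= (bigD1 j)//= -addrA lerDl addr_ge0//.
  by apply: sumr_ge0 => ? _; exact: normc_ge0.
by do 2 apply: sumr_ge0 => ? _; exact: normc_ge0.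
Qed.

Lemma smxD m n (X Y : 'M[C]_(m, n)) : smx (X + Y) <= smx X + smx Y.
Proof.
rewrite /smx -big_split; apply: ler_sum => i _; rewrite -big_split.
by apply: ler_sum => j _; rewrite mxE normcD.
Qed.

Lemma smxZ m n a (X : 'M[C]_(m, n)) : smx (a *: X) = normc a * smx X.
Proof.
rewrite /smx mulr_sumr; apply: eq_bigr => i _; rewrite mulr_sumr.
by apply: eq_bigr => j _; rewrite mxE Normc.normcM.
Qed.

Lemma smxN m n (X : 'M[C]_(m, n)) : smx (- X) = smx X.
Proof.
by rewrite /smx; do 2 apply: eq_bigr => ? _; rewrite mxE normcN.
Qed.

Lemma smxM m n p (X : 'M[C]_(m, n)) (Y : 'M[C]_(n, p)) :
  smx (X *m Y) <= smx X * smx Y.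
Proof.
rewrite /smx mulr_suml; apply: ler_sum => i _.
apply: (@le_trans _ _ (\sum_j \sum_k normc (X i k) * normc (Y k j))).
  apply: ler_sum => j _; rewrite mxE (le_trans (normc_sum _ _ _))//.
  by apply: ler_sum => k _; rewrite Normc.normcM.
rewrite exchange_big mulr_suml; apply: ler_sum => k _ /=.
rewrite -mulr_sumr ler_wpM2l ?normc_ge0// (bigD1 k)//= lerDl.
by do 2 apply: sumr_ge0 => ? _; exact: normc_ge0.
Qed.

(** Estimating entries rather than [smx (X ^+ n)] gives the constant 1: the entries of X^0 are at
    most 1, while its [smx] is N. *)
Lemma geom_le_mx N (X : 'M[C]_N) i j :
  geom_le (fun n => (X ^+ n) i j) 1 (smx X).
Proof.
move=> n; rewrite mul1r; elim: n i j => [|n IH] i j.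
  by rewrite !expr0 mxE normc_nat; case: (i == j).
rewrite exprS mxE (le_trans (normc_sum _ _ _))//.
apply: (@le_trans _ _ (\sum_k normc (X i k) * smx X ^+ n)).
  by apply: ler_sum => k _; rewrite Normc.normcM ler_wpM2l ?normc_ge0.
rewrite -mulr_suml exprS ler_wpM2r ?exprn_ge0 ?smx_ge0//.
rewrite /smx [leRHS](bigD1 i)//= lerDl.
by do 2 apply: sumr_ge0 => ? _; exact: normc_ge0.
Qed.

Definition mxpowser N c (X : 'M[C]_N) : 'M[C]_N :=
  \matrix_(i, j) csum c (fun n => (X ^+ n) i j).

Lemma mxlimn_cvg m n (u : nat -> 'M[C]_(m, n)) (L : 'M[C]_(m, n)) :
  (forall i j, (fun k => u k i j : Co) @ \oo --> (L i j : Co)) -> mxlimn u = L.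
Proof. by move=> uL; apply/matrixP => i j; rewrite mxE; exact: cvg_limnC. Qed.

Lemma mxseries_mxpowser N c (X : 'M[C]_N) :
  mxseries (fun n => c n *: X ^+ n) = mxpowser c X.
Proof.
apply/matrixP => i j; rewrite !mxE; apply: eq_limnC => k.
by rewrite /series/= summxE; apply: eq_bigr => n _; rewrite mxE.
Qed.

Lemma entire_mx_powser N c K (X : 'M[C]_N) : fact_le c K 0 ->
  entire_mx (powser c) X = mxpowser c X.
Proof.
move=> ck; rewrite -mxseries_mxpowser /entire_mx; congr (mxseries _).
by apply/funext => n; rewrite (derive1n_powser0 n ck).
Qed.

Lemma csum_lin (I : finType) (F : I -> C) (y : I -> nat -> C) c K P r :
  fact_le c K 0 -> (forall i, geom_le (y i) P r) ->
  csum c (fun n => \sum_i F i * y i n) = \sum_i F i * csum c (y i).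
Proof.
move=> ck yr; apply: cvg_limnC.
rewrite (_ : series _ = fun n => \sum_i F i * series (fun n => c n * y i n) n).
  apply: (@cvg_sum _ Co) => i.
  by apply: cvgM; [exact: cvg_cst|exact: cvg_csum ck (yr i)].
apply/funext => n; rewrite /series/=.
under [RHS]eq_bigr do rewrite mulr_sumr.
rewrite exchange_big/=; apply: eq_bigr => k _.
by rewrite mulr_sumr; apply: eq_bigr => i _; rewrite mulrCA.
Qed.

(** This is [csum_ddcoef] entry by entry at x_n = (X^n)_{ij}, the shifted sum being read as a
    product by X on the left. *)
Lemma mxpowser_ddcoef N c K k a (X : 'M[C]_N) : fact_le c K k ->
  mxpowser c X = (powser c a)%:M + (X - a%:M) *m mxpowser (ddcoef c a) X.
Proof.
move=> ck; have dk := fact_leW (fact_le_ddcoef a ck).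
apply/matrixP => i j.
rewrite mulmxBl mul_scalar_mx !mxE.
rewrite (csum_ddcoef a ck (geom_le_mx X i j)) expr0 mxE mulr_natr.
congr (_ + (_ - _)).
transitivity (\sum_l X i l * csum (ddcoef c a) (fun n => (X ^+ n) l j)).
  rewrite -(csum_lin _ dk (fun l => geom_le_mx X l j)).
  by apply: eq_csum => n; rewrite exprS mxE.
by apply: eq_bigr => l _; rewrite mxE.
Qed.

Lemma smx_mxpowser N c K (X : 'M[C]_N) : fact_le c K 0 ->
  smx (mxpowser c X) <= N%:R * (N%:R * (K * expR (smx X))).
Proof.
move=> ck; rewrite /smx.
apply: (@le_trans _ _ (\sum_(i < N) \sum_(j < N) K * expR (smx X))).
  apply: ler_sum => i _; apply: ler_sum => j _; rewrite mxE.
  by have := csum_le ck (geom_le_mx X i j); rewrite mulr1.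
by rewrite !sumr_const !card_ord !mulr_natl.
Qed.

End MatrixPowerSeries.

(** * Coefficients of the functions phi_k *)

Section PhiCoefficients.
Context {R : realType}.
Local Notation C := R[i].
Implicit Types (z : nat -> C) (t : R).

Fixpoint phicoef z t k : nat -> C :=
  if k is k'.+1 then ddcoef (phicoef z t k') (- (t%:C * z k'))
  else fun n => (n`!%:R)^-1.

(** One [r] bounds all the nodes, so each divided difference costs at most the same factor e^r. *)
Lemma fact_le_phicoef z t r k : (forall i, normc (t%:C * z i) <= r) ->
  fact_le (phicoef z t k) (expR r ^+ k) k.
Proof.
move=> zr; elim: k => [n|k IH].
  rewrite addn0 expr0 mul1r /= -[n`!%:R](rmorph_nat (real_complex R)).
  by rewrite -fmorphV normc_real ger0_norm// invr_ge0.
move=> n; apply: le_trans (fact_le_ddcoef _ IH n) _.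
rewrite ler_wpM2r ?invr_ge0// exprSr ler_wpM2l ?exprn_ge0 ?expR_ge0//.
by rewrite ler_expR normcN.
Qed.

Lemma phi_powser z t r k : (forall i, normc (t%:C * z i) <= r) ->
  phi z t k = powser (phicoef z t k).
Proof.
move=> zr; elim: k => [|k IH].
  apply/funext => w; rewrite /= /cexp /powser /csum; apply: eq_limnC => n.
  by rewrite /series/=; apply: eq_bigr => k _; rewrite mulrC.
by rewrite /= IH (divdiff_powser _ (fact_le_phicoef k zr)).
Qed.

Lemma expmx_mxpowser N z t (X : 'M[C]_N) : expmx X = mxpowser (phicoef z t 0) X.
Proof. exact: mxseries_mxpowser. Qed.

Lemma phi_entryE m (H : 'M[C]_m.+1) z t r k :
  (forall i, normc (t%:C * z i) <= r) ->
  phi_entry H z t k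
  = mxpowser (phicoef z t k) (- (t%:C *: H)) ord_max ord0.
Proof.
move=> zr; rewrite /phi_entry (phi_powser k zr).
by rewrite (entire_mx_powser _ (fact_leW (fact_le_phicoef k zr))).
Qed.

End PhiCoefficients.

(** * Newton expansion of the Arnoldi error *)

Lemma enorm_eq0 (R : realType) N (x : 'cV[R[i]]_N) :
  (enorm x == 0) = (x == 0).
Proof.
have s0 : forall i, true -> 0 <= normc (x i 0) ^+ 2 by move=> *; exact: sqr_ge0.
rewrite /enorm sqrtr_eq0; apply/idP/eqP => [le0|->].
  have /psumr_eq0P h0 : \sum_i normc (x i 0) ^+ 2 = 0.
    by apply/le_anti; rewrite le0 sumr_ge0.
  apply/matrixP => i j; rewrite (ord1 j) mxE.
  by apply/Normc.eq0_normc/eqP; rewrite -sqrf_eq0; apply/eqP; exact: h0.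
by rewrite big1// => i _; rewrite mxE Normc.normc0 expr0n.
Qed.

Section NewtonExpansion.
Context {R : realType}.
Local Notation C := R[i].
Local Notation Co := (R[i]^o).
Variables (N m : nat) (A : 'M[C]_N) (v : 'cV[C]_N).
Variables (V : 'M[C]_(N, m.+1)) (H : 'M[C]_m.+1) (h : R) (w : 'cV[C]_N).
Variables (z : nat -> C) (r : R) (t : R).
Hypothesis arn : arnoldi A v V H h w.
Hypothesis vn0 : v != 0.
Hypothesis zr : forall i, normc (t%:C * z i) <= r.

Let b := enorm v.
Let X := - (t%:C *: H).
Let Y := - (t%:C *: A).
Let e1 : 'cV[C]_m.+1 := delta_mx ord0 0.
Let c k := phicoef z t k.
Let p k := mxpowser (c k) X ord_max ord0.

Lemma arnoldi_start : b%:C *: (V *m e1) = v.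
Proof.
rewrite /e1 -colE (arnoldi_first arn) scalerA -rmorphM /=.
by rewrite mulfV ?enorm_eq0// scale1r.
Qed.

Lemma arnoldi_scaled :
  Y *m V = V *m X - (t * h)%:C *: (w *m delta_mx 0 ord_max).
Proof.
rewrite /Y /X mulNmx -scalemxAl (arnoldi_rel arn) scalerDr scalerA -rmorphM.
by rewrite opprD mulmxN -scalemxAr.
Qed.

(** The defect of the Arnoldi approximation with phi_k in place of exp; at k = 0 it is the error
    itself. *)
Definition newton_rem k : 'cV[C]_N :=
  mxpowser (c k) Y *m v - b%:C *: (V *m mxpowser (c k) X *m e1).

(** Both terms split off phi_k(a) v, since b V e_1 = v, and these parts cancel. Moving V across X -
    a produces V (X - a) = (Y - a) V + t h w e_m^T, whose rank-one part gives the multiple of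
    [w]. *)
Lemma newton_remS k :
  newton_rem k = (Y - (- (t%:C * z k))%:M) *m newton_rem k.+1
                 - (t * b * h)%:C * p k.+1 *: w.
Proof.
set a := - (t%:C * z k); have ck := fact_le_phicoef k zr.
rewrite /newton_rem.
rewrite (mxpowser_ddcoef a X ck) (mxpowser_ddcoef a Y ck).
rewrite -[ddcoef _ _]/(c k.+1); set F := mxpowser _ X; set G := mxpowser _ Y.
set f := powser _ a.
have pE : w *m delta_mx 0 ord_max *m F *m e1 = p k.+1 *: w.
  have -> : p k.+1 *: w = w *m (p k.+1)%:M by rewrite mul_mx_scalar.
  have -> : (p k.+1)%:M = (delta_mx 0 ord_max : 'rV[C]_m.+1) *m F *m e1.
    apply/matrixP => i j.
    by rewrite (ord1 i) (ord1 j) -rowE -colE [LHS]mxE mulr1n [RHS]mxE [RHS]mxE.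
  by rewrite !mulmxA.
have E : V *m (X - a%:M) *m F *m e1 =
    (Y - a%:M) *m (V *m F *m e1) + (t * h)%:C * p k.+1 *: w.
  rewrite -scalerA -pE mulmxBr mulmxBl mulmxBl !mulmxA mulmxBl mulmxBl mulmxBl.
  rewrite arnoldi_scaled !mulmxBl -!scalemxAl mul_mx_scalar mul_scalar_mx.
  by rewrite -!scalemxAl addrAC subrK.
have -> : (f%:M + (Y - a%:M) *m G) *m v = f *: v + (Y - a%:M) *m (G *m v).
  by rewrite mulmxDl mul_scalar_mx mulmxA.
have -> : b%:C *: (V *m (f%:M + (X - a%:M) *m F) *m e1) =
    f *: v + b%:C *: ((Y - a%:M) *m (V *m F *m e1) + (t * h)%:C * p k.+1 *: w).
  rewrite -E mulmxDr mulmxDl mul_mx_scalar -scalemxAl scalerDr mulmxA.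
  by rewrite scalerA mulrC -scalerA arnoldi_start.
rewrite scalerDr opprD addrACA subrr add0r mulmxBr -scalemxAr opprD addrA.
congr (_ - _ - _); rewrite scalerA mulrA -rmorphM /=.
by congr (_%:C * _ *: _); ring.
Qed.

(** Since Y - a_k = - t (A - z_k), each step contributes one factor - t and one factor of q. The new
    factor stands on the right of [q_mx A z n], next to the remainder, as in the product defining
    [q_mx]. *)
Lemma newton_expansion n :
  newton_rem 0 =
  \sum_(0 <= k < n) (- (t * b * h))%:C *:
      ((((- t) ^+ k)%:C * p k.+1) *: (q_mx A z k *m w))
  + ((- t) ^+ n)%:C *: (q_mx A z n *m newton_rem n).
Proof.
elim: n => [|n IH].
  by rewrite big_geq// add0r expr0 scale1r /q_mx big_ord0 mul1mx.
rewrite (big_nat_recr _ _ _ (leq0n n)) -[RHS]addrA.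
apply: (etrans IH); congr (_ + _).
have qS : q_mx A z n.+1 = q_mx A z n *m (A - (z n)%:M).
  by rewrite /q_mx big_ord_recr.
have YE : Y - (- (t%:C * z n))%:M = (- t)%:C *: (A - (z n)%:M).
  have -> : (- t)%:C = - t%:C by rewrite rmorphN.
  by rewrite /Y scalerBr scale_scalar_mx scaleNr mulNr.
rewrite newton_remS YE qS; move: (newton_rem n.+1) => D.
rewrite mulmxBr scalerBr -!scalemxAr -scalemxAl -scalemxAr !scalerA -rmorphM.
rewrite -exprSr mulmxA addrC; congr (_ + _).
rewrite -scaleNr; congr (_ *: _).
by rewrite mulrCA [in RHS]rmorphN mulNr.
Qed.

End NewtonExpansion.

(** * Convergence of the Newton expansion *)

Section NewtonSeries.
Context {R : realType}.
Local Notation C := R[i].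
Local Notation Co := (R[i]^o).

Lemma smx_q_mx N (A : 'M[C]_N) (z : nat -> C) (r : R) n :
  (forall i, normc (z i) <= r) ->
  smx (q_mx A z n) <= smx (1%:M : 'M[C]_N) * (smx A + r * smx (1%:M : 'M[C]_N)) ^+ n.
Proof.
move=> zr; set o := smx (1%:M : 'M[C]_N).
have o0 : 0 <= o by exact: smx_ge0.
have r0 : 0 <= r by exact: le_trans (normc_ge0 _) (zr 0%N).
elim: n => [|n IH]; first by rewrite /q_mx big_ord0 expr0 mulr1.
rewrite /q_mx big_ord_recr -/(q_mx A z n); apply: le_trans (smxM _ _) _.
rewrite exprSr mulrA; apply: ler_pM; rewrite ?smx_ge0//.
apply: le_trans (smxD _ _) _; rewrite smxN lerD2l -scalemx1 smxZ.
by rewrite ler_wpM2r.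
Qed.

Lemma arnoldi_err2E N m (A : 'M[C]_N) (v : 'cV[C]_N) (V : 'M[C]_(N, m.+1))
    (H : 'M[C]_m.+1) (h : R) (w : 'cV[C]_N) (z : nat -> C) (r t : R) :
  arnoldi A v V H h w -> v != 0 -> (forall i, normc (z i) <= r) -> 0 < t ->
  arnoldi_err2 A v H h w z t =
  arnoldi_err A v V H t + (t * enorm v * h)%:C * phi_entry H z t 1 *: w.
Proof.
move=> arn v0 zr t0.
have tzr i : normc (t%:C * z i) <= t * r.
  by rewrite Normc.normcM normc_real gtr0_norm// ler_wpM2l// ltW.
have b0 : enorm v != 0 by rewrite enorm_eq0.
set b := enorm v; set s := (t * b * h)%:C.
have s0 : s != 0.
  rewrite fmorph_eq0 mulf_neq0// ?mulf_neq0// ?(gt_eqF t0)//.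
  by rewrite gt_eqF// (arnoldi_next_pos arn).
set X := - (t%:C *: H); set Y := - (t%:C *: A).
pose D := newton_rem A v V H z t.
have D0 : arnoldi_err A v V H t = D 0%N.
  by rewrite /D /newton_rem /arnoldi_err !(expmx_mxpowser z t).
pose e n := ((- t) ^+ n)%:C *: (q_mx A z n *m D n).
pose S := series (fun k => (((- t) ^+ k.+1)%:C * phi_entry H z t k.+2) *:
  (q_mx A z k.+1 *m w)).
set L := arnoldi_err A v V H t + _.
have NE n : D 0%N = \sum_(0 <= k < n) (- s) *:
    ((((- t) ^+ k)%:C * phi_entry H z t k.+1) *: (q_mx A z k *m w)) + e n.
  apply: (etrans (newton_expansion arn v0 tzr n)); congr (_ + _).
  by apply: eq_bigr => k _; rewrite (phi_entryE H k.+1 tzr) rmorphN.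
(* The second error starts at q_1, so n of its terms correspond to n + 1 steps of the expansion. The
   term of q_0 is absorbed in [L], and the nonzero factor [s] is divided out. *)
have SE n : S n = - s^-1 *: L + s^-1 *: e n.+1.
  apply: (scalerI s0); rewrite scalerDr [s *: (- _ *: L)]scalerA.
  rewrite [s *: (s^-1 *: _)]scalerA mulrN (mulfV s0) scaleN1r scale1r.
  rewrite /L D0 (NE n.+1) (big_nat_recl _ _ _ (leq0n n)).
  move: (e n.+1) => en; rewrite -scaler_sumr -[\sum_(_ <= _ < _) _]/(S n).
  rewrite expr0 /q_mx big_ord0 mul1mx mul1r scalerA mulNr !scaleNr.
  move: (S n) (s * _) => Sn c.
  move: (s *: Sn) (c *: w) => x y.
  by rewrite (addrC (_ + en)) !addrA subrr add0r opprD opprK subrK.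
pose o := smx (1%:M : 'M[C]_N); pose e1 : 'cV[C]_m.+1 := delta_mx ord0 0.
(* [Q n] is the decay gained by n divided differences; [M] collects what does not depend on n. *)
pose Q n := expR (t * r) ^+ n / n`!%:R.
pose B k (Z : 'M[C]_k) := k%:R * (k%:R * expR (smx Z)).
pose M := B N Y * smx v + b * (smx V * B m.+1 X * smx e1).
have smP n k (Z : 'M[C]_k) : smx (mxpowser (phicoef z t n) Z) <= B k Z * Q n.
  apply: le_trans (smx_mxpowser _ (fact_leW (fact_le_phicoef n tzr))) _.
  by rewrite le_eqVlt /B /Q; apply/orP; left; apply/eqP; ring.
have smD n : smx (D n) <= M * Q n.
  have -> : M * Q n = B N Y * Q n * smx v
      + b * (smx V * (B m.+1 X * Q n) * smx e1) by rewrite /M; ring.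
  apply: le_trans (smxD _ _) _; apply: lerD.
    apply: le_trans (smxM _ _) _; apply: ler_wpM2r; first exact: smx_ge0.
    exact: smP.
  rewrite smxN smxZ normc_real ger0_norm; last exact: sqrtr_ge0.
  apply: ler_wpM2l; first exact: sqrtr_ge0.
  apply: le_trans (smxM _ _) _; apply: ler_wpM2r; first exact: smx_ge0.
  apply: le_trans (smxM _ _) _; apply: ler_wpM2l; first exact: smx_ge0.
  exact: smP.
have sm n : smx (e n) <=
    o * M * ((t * (smx A + r * o) * expR (t * r)) ^+ n / n`!%:R).
  have -> : o * M * ((t * (smx A + r * o) * expR (t * r)) ^+ n / n`!%:R) =
      t ^+ n * ((o * (smx A + r * o) ^+ n) * (M * Q n)).
    by rewrite /Q !exprMn; ring.
  rewrite /e smxZ normc_real normrX normrN (gtr0_norm t0).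
  apply: ler_wpM2l; first by rewrite exprn_ge0 ?(ltW t0).
  apply: le_trans (smxM _ _) _.
  by apply: ler_pM; [exact: smx_ge0|exact: smx_ge0|exact: smx_q_mx|exact: smD].
rewrite /arnoldi_err2 /mxseries (mxlimn_cvg (L := - s^-1 *: L)).
  by rewrite scalerA rmorphN -/s mulrN mulNr opprK (mulfV s0) scale1r.
move=> i j.
have -> : (fun k => S k i j) = (fun k => (- s^-1 *: L) i j + s^-1 * e k.+1 i j).
  by apply/funext => k; rewrite SE mxE [X in _ + X]mxE.
rewrite -[X in _ --> X]addr0 -(mulr0 s^-1); apply: cvgD; first exact: cvg_cst.
apply: cvgM; first exact: cvg_cst.
rewrite (cvg_shiftS (fun n => e n i j : Co)).
apply: cvg0_exp_bound => n; apply: le_trans (sm n).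
exact: normc_le_smx.
Qed.

End NewtonSeries.

(** * Exponential generating functions *)

Section ExponentialGeneratingFunctions.
Context {R : realType}.
Local Notation C := R[i].
Local Notation Co := (R[i]^o).
Implicit Types (x y : nat -> C) (a : C) (t : R).

Definition geometric_growth x := exists P r, 0 <= r /\ geom_le x P r.

(** The factor 1/n! is kept apart from [x], so that d/dt is a shift of [x] and geometric growth of
    [x] ensures convergence for every t. *)
Definition egf x t : C :=
  csum (fun n => (n`!%:R)^-1) (fun n => x n * t%:C ^+ n).

Lemma geom_le_mono x P r s : 0 <= r -> r <= s -> geom_le x P r -> geom_le x P s.
Proof.
move=> r0 rs xr n; apply: le_trans (xr n) _.
rewrite ler_wpM2l ?(geom_le_ge0 xr)// lerXn2r ?nnegrE//.
exact: le_trans r0 rs.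
Qed.

Lemma geometric_growthD x y : geometric_growth x -> geometric_growth y ->
  geometric_growth (fun n => x n + y n).
Proof.
move=> [P [r [r0 xr]]] [Q [s [s0 ys]]]; exists (P + Q), (r + s).
split=> [|n]; first exact: addr_ge0.
rewrite mulrDl; apply: le_trans (normcD _ _) _; apply: lerD.
  by apply: (geom_le_mono r0 _ xr); rewrite lerDl.
by apply: (geom_le_mono s0 _ ys); rewrite lerDr.
Qed.

Lemma geometric_growthZ a x : geometric_growth x ->
  geometric_growth (fun n => a * x n).
Proof.
move=> [P [r [r0 xr]]]; exists (normc a * P), r; split=> // n.
by rewrite Normc.normcM -mulrA ler_wpM2l ?normc_ge0.
Qed.

Lemma geometric_growth0 : geometric_growth (fun=> 0).
Proof. by exists 0, 0; split=> // n; rewrite Normc.normc0 mul0r. Qed.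

Lemma geometric_growth_sum (I : Type) (s : seq I) (x : I -> nat -> C) :
  (forall i, geometric_growth (x i)) ->
  geometric_growth (fun n => \sum_(i <- s) x i n).
Proof.
move=> xg; elim: s => [|i s IH].
  rewrite (_ : (fun n => _) = fun=> 0); first exact: geometric_growth0.
  by apply/funext => n; rewrite big_nil.
rewrite (_ : (fun n => _) = fun n => x i n + \sum_(i <- s) x i n).
  exact: geometric_growthD.
by apply/funext => n; rewrite big_cons.
Qed.

Lemma geometric_growth_mx N (X : 'M[C]_N) i j :
  geometric_growth (fun n => (X ^+ n) i j).
Proof. by exists 1, (smx X); split; [exact: smx_ge0|exact: geom_le_mx]. Qed.

Lemma geometric_growth_mulmx m n p q (X : nat -> 'M[C]_(n, p)) (U : 'M[C]_(m, n))
    (W : 'M[C]_(p, q)) i j :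
  (forall i j, geometric_growth (fun n => X n i j)) ->
  geometric_growth (fun n => (U *m X n *m W) i j).
Proof.
move=> Xg; rewrite (_ : (fun n => _) = fun n =>
  \sum_k \sum_l (W k j * U i l) * X n l k).
  do 2 (apply: geometric_growth_sum => ?); exact: geometric_growthZ.
apply/funext => k; rewrite mxE; apply: eq_bigr => l _; rewrite mxE mulr_suml.
by apply: eq_bigr => k' _; rewrite mulrC mulrA.
Qed.

Lemma geometric_growth_horner_seq a x : geometric_growth x ->
  geometric_growth (horner_seq a x).
Proof.
move=> [P [r [r0 xr]]]; exists P, (r + normc a + 1); split.
  by rewrite !addr_ge0 ?normc_ge0.
exact: geom_le_horner_seq.
Qed.

Lemma geometric_growthS x : geometric_growth x ->
  geometric_growth (fun n => x n.+1).
Proof.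
by move=> [P [r [r0 xr]]]; exists (P * r), r; split=> //; exact: geom_leS.
Qed.

Lemma fact_le_invf : fact_le (fun n => (n`!%:R)^-1 : C) 1 0.
Proof.
move=> n; rewrite addn0 mul1r -[n`!%:R](rmorph_nat (real_complex R)).
by rewrite -fmorphV normc_real ger0_norm// invr_ge0.
Qed.

Lemma cvg_egf x t : geometric_growth x ->
  series (fun n => (n`!%:R)^-1 * (x n * t%:C ^+ n) : Co) @ \oo --> (egf x t : Co).
Proof.
move=> [P [r [r0 xr]]]; apply: (cvg_csum (P := P) (r := r * `|t|) fact_le_invf).
move=> n; rewrite Normc.normcM normcX normc_real exprMn mulrA.
by rewrite ler_wpM2r// exprn_ge0.
Qed.

Lemma egfD x y t : geometric_growth x -> geometric_growth y ->
  egf (fun n => x n + y n) t = egf x t + egf y t.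
Proof.
move=> xg yg; apply: cvg_limnC.
rewrite (_ : series _ = fun n => series (fun n => (n`!%:R)^-1 * (x n * t%:C ^+ n)) n
    + series (fun n => (n`!%:R)^-1 * (y n * t%:C ^+ n)) n).
  by apply: cvgD; exact: cvg_egf.
apply/funext => n; rewrite /series/= -big_split; apply: eq_bigr => i _ /=.
by rewrite mulrDl mulrDr.
Qed.

Lemma egfZ a x t : geometric_growth x ->
  egf (fun n => a * x n) t = a * egf x t.
Proof.
move=> xg; apply: cvg_limnC.
rewrite (_ : series _ = fun n =>
  a * series (fun n => (n`!%:R)^-1 * (x n * t%:C ^+ n)) n).
  by apply: cvgM; [exact: cvg_cst|exact: cvg_egf].
apply/funext => n; rewrite /series/= mulr_sumr; apply: eq_bigr => i _ /=.
by rewrite -mulrA mulrCA.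
Qed.

Lemma egf_sum (I : Type) (s : seq I) (x : I -> nat -> C) t :
  (forall i, geometric_growth (x i)) ->
  egf (fun n => \sum_(i <- s) x i n) t = \sum_(i <- s) egf (x i) t.
Proof.
move=> xg; elim: s => [|i s IH].
  rewrite big_nil (_ : (fun n => _) = fun n => 0 * 0).
    by rewrite egfZ ?mul0r//; exact: geometric_growth0.
  by apply/funext => n; rewrite big_nil mul0r.
rewrite big_cons -IH -egfD//; last exact: geometric_growth_sum.
by apply: eq_csum => n; rewrite big_cons.
Qed.

Lemma egf_mulmx m n p q (X : nat -> 'M[C]_(n, p)) (U : 'M[C]_(m, n))
    (W : 'M[C]_(p, q)) i j t :
  (forall i j, geometric_growth (fun n => X n i j)) ->
  egf (fun n => (U *m X n *m W) i j) t =
  (U *m (\matrix_(i, j) egf (fun n => X n i j) t) *m W) i j.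
Proof.
move=> Xg; rewrite (_ : (fun n => _) = fun n =>
  \sum_k \sum_l (W k j * U i l) * X n l k).
  rewrite egf_sum => [|k]; last first.
    by apply: geometric_growth_sum => l; exact: geometric_growthZ.
  rewrite mxE; apply: eq_bigr => k _; rewrite egf_sum => [|l]; last first.
    exact: geometric_growthZ.
  rewrite mxE mulr_suml; apply: eq_bigr => l _.
  rewrite egfZ; last exact: Xg.
  by rewrite mxE -mulrA mulrC.
apply/funext => k; rewrite mxE; apply: eq_bigr => l _; rewrite mxE mulr_suml.
by apply: eq_bigr => k' _; rewrite mulrC mulrA.
Qed.

Lemma egf0 x : geometric_growth x -> egf x 0 = x 0%N.
Proof.
move=> xg; apply: cvg_limnC; rewrite -cvg_shiftS /=.
rewrite (_ : (fun n => _) = fun=> x 0%N); first exact: cvg_cst.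
apply/funext => n; rewrite /series/= big_nat_recl//= invr1 mul1r expr0 mulr1.
by rewrite big1 ?addr0// => i _; rewrite exprS mul0r !mulr0.
Qed.

(** Here [p] is [Re] or [Im]: derivatives in t are taken on real power series, with coefficients
    p(x_n) / n!. *)
Let pseries_part (p : C -> R) x t : geometric_growth x ->
  (forall n, p ((n`!%:R)^-1 * (x n * t%:C ^+ n)) = (n`!%:R)^-1 * p (x n) * t ^+ n) ->
  (forall u : nat -> C, forall n, p (series u n) = series (fun n => p (u n)) n) ->
  (forall (u : nat -> Co) (l : Co), u @ \oo --> l ->
    (fun n => p (u n)) @ \oo --> p l) ->
  pseries (fun n => (n`!%:R)^-1 * p (x n)) t @ \oo --> p (egf x t).
Proof.
move=> xg pE pS pc; have := pc _ _ (cvg_egf (t := t) xg).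
rewrite (_ : (fun n => _) = pseries (fun n => (n`!%:R)^-1 * p (x n)) t)//.
by apply/funext => n; rewrite pS /pseries /series; apply: eq_bigr => i _.
Qed.

Lemma egf_termE x t n : (n`!%:R)^-1 * (x n * t%:C ^+ n) =
  ((n`!%:R)^-1 * t ^+ n)%:C * x n.
Proof.
rewrite rmorphM rmorphXn fmorphV rmorph_nat; ring.
Qed.

Lemma cvg_pseries_Re x t : geometric_growth x ->
  pseries (fun n => (n`!%:R)^-1 * Re (x n)) t @ \oo --> Re (egf x t).
Proof.
move=> xg; apply: pseries_part => //.
- move=> n; rewrite egf_termE; case: (x n) => a b /=; rewrite mul0r subr0; ring.
- by move=> u n; exact: Re_sum.
- by move=> u l; exact: cvg_Re.
Qed.

Lemma cvg_pseries_Im x t : geometric_growth x ->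
  pseries (fun n => (n`!%:R)^-1 * Im (x n)) t @ \oo --> Im (egf x t).
Proof.
move=> xg; apply: pseries_part => //.
- move=> n; rewrite egf_termE; case: (x n) => a b /=; rewrite mul0r addr0; ring.
- by move=> u n; exact: Im_sum.
- by move=> u l; exact: cvg_Im.
Qed.

Lemma pseries_diffs_egf (p : nat -> R) :
  pseries_diffs (fun n => (n`!%:R)^-1 * p n) = fun n => (n`!%:R)^-1 * p n.+1.
Proof.
apply/funext => n; rewrite /pseries_diffs factS natrM invfM mulrA mulVKf//.
Qed.

Lemma is_derive_pseries (F dF ddF : R -> R) (p : nat -> R) t :
  (forall t, pseries (fun n => (n`!%:R)^-1 * p n) t @ \oo --> F t) ->
  (forall t, pseries (fun n => (n`!%:R)^-1 * p n.+1) t @ \oo --> dF t) ->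
  (forall t, pseries (fun n => (n`!%:R)^-1 * p n.+2) t @ \oo --> ddF t) ->
  is_derive t (1 : R) F (dF t).
Proof.
move=> pF pdF pddF.
have FE : F = fun t => limn (pseries (fun n => (n`!%:R)^-1 * p n) t).
  by apply/funext => s; apply/esym/cvg_lim.
have dFE : dF t = limn (pseries (pseries_diffs (fun n => (n`!%:R)^-1 * p n)) t).
  by apply/esym/cvg_lim => //; rewrite pseries_diffs_egf.
(* Differentiability at t follows from convergence of the series and of its first two derived series
   at a point beyond |t|; |t| + 1 is such a point. *)
rewrite FE dFE; apply: (@pseries_snd_diffs _ _ (`|t| + 1)).
- exact: cvgP (pF _).
- by rewrite pseries_diffs_egf; exact: cvgP (pdF _).
- rewrite pseries_diffs_egf (pseries_diffs_egf (fun n => p n.+1)).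
  exact: cvgP (pddF _).
- by rewrite [ltRHS]ger0_norm ?addr_ge0// ltrDl.
Qed.

Lemma is_derive_Re_egf x t : geometric_growth x ->
  is_derive t (1 : R) (fun t => Re (egf x t)) (Re (egf (fun n => x n.+1) t)).
Proof.
move=> x0; have x1 := geometric_growthS x0; have x2 := geometric_growthS x1.
exact: (is_derive_pseries t (fun s => cvg_pseries_Re (t := s) x0)
  (fun s => cvg_pseries_Re (t := s) x1) (fun s => cvg_pseries_Re (t := s) x2)).
Qed.

Lemma is_derive_Im_egf x t : geometric_growth x ->
  is_derive t (1 : R) (fun t => Im (egf x t)) (Im (egf (fun n => x n.+1) t)).
Proof.
move=> x0; have x1 := geometric_growthS x0; have x2 := geometric_growthS x1.
exact: (is_derive_pseries t (fun s => cvg_pseries_Im (t := s) x0)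
  (fun s => cvg_pseries_Im (t := s) x1) (fun s => cvg_pseries_Im (t := s) x2)).
Qed.

End ExponentialGeneratingFunctions.

(** * The differential equation of the second error *)

Section ErrorEquation.
Context {R : realType}.
Local Notation C := R[i].
Variables (N m : nat) (A : 'M[C]_N) (v : 'cV[C]_N).
Variables (V : 'M[C]_(N, m.+1)) (H : 'M[C]_m.+1) (h : R) (w : 'cV[C]_N).
Variables (z : nat -> C).
Hypothesis arn : arnoldi A v V H h w.
Hypothesis vn0 : v != 0.

Let b := enorm v.
Let e1 : 'cV[C]_m.+1 := delta_mx ord0 0.
Let y n := ((- H) ^+ n) ord_max ord0.
(** The coefficients of t phi_1(t), by [phi1_egf]. The Horner recurrence gam_{n+1} = - z_0 gam_n +
    y_n is the differential identity for t phi_1. *)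
Let gam := horner_seq (- z 0%N) y.

Definition err2_coef n : 'cV[C]_N :=
  (- A) ^+ n *m v - b%:C *: (V *m (- H) ^+ n *m e1) + ((b * h)%:C * gam n) *: w.

Definition err2_fun (t : R) : 'cV[C]_N :=
  \col_i egf (fun n => err2_coef n i 0) t.

Definition err2_deriv (t : R) : 'cV[C]_N :=
  \col_i egf (fun n => err2_coef n.+1 i 0) t.

Lemma exprNZ k (X : 'M[C]_k) (t : R) n :
  (- (t%:C *: X)) ^+ n = t%:C ^+ n *: (- X) ^+ n.
Proof.
rewrite -scalerN; elim: n => [|n IH]; first by rewrite !expr0 scale1r.
rewrite !exprS IH -[LHS]scalemxAl -scalemxAr scalerA//.
Qed.

Lemma expmx_egf k (X : 'M[C]_k) (t : R) :
  expmx (- (t%:C *: X)) = \matrix_(i, j) egf (fun n => ((- X) ^+ n) i j) t.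
Proof.
rewrite (expmx_mxpowser z t); apply/matrixP => i j; rewrite !mxE.
by apply: eq_csum => n; rewrite exprNZ mxE [_ * t%:C ^+ _]mulrC.
Qed.

Let geo_y : geometric_growth y.
Proof. exact: geometric_growth_mx. Qed.

Let geo_gam : geometric_growth gam.
Proof. exact: geometric_growth_horner_seq. Qed.

Lemma horner_seqS (a : C) x n :
  horner_seq a x n.+1 = a * horner_seq a x n + x n.
Proof. by []. Qed.

(** The entry of index n + 1 is homogeneous of degree n when a has degree 1 and x_i has degree i. *)
Lemma horner_seqZ (a s : C) x n :
  horner_seq (s * a) (fun n => s ^+ n * x n) n.+1 = s ^+ n * horner_seq a x n.+1.
Proof.
elim: n => [|n IH]; first by rewrite !horner_seqS !mulr0 !add0r.
rewrite (horner_seqS _ _ n.+1) IH (horner_seqS a x n.+1) exprS; ring.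
Qed.

(** The rearrangement writes phi_1 as a sum of h_{n+1} / (n+1)!, and homogeneity extracts t^n from
    h_{n+1}; the prefactor t completes t^(n+1). The sum may start at n = 0 because [gam 0] is 0. *)
Lemma phi1_egf (t : R) : t%:C * phi_entry H z t 1 = egf gam t.
Proof.
pose a := - (t%:C * z 0%N); have ck := @fact_le_invf R.
have -> : phi_entry H z t 1 =
    csum (ddcoef (fun n => (n`!%:R)^-1) a) (fun n => t%:C ^+ n * y n).
  have dk := fact_leW (fact_le_ddcoef a ck).
  rewrite /phi_entry -[phi z t 1]/(divdiff (phi z t 0) a).
  have -> : phi z t 0 = powser (fun n => (n`!%:R)^-1).
    apply/funext => u; rewrite /= /cexp /powser /csum; apply: eq_limnC => n.
    by rewrite /series/=; apply: eq_bigr => k _; rewrite mulrC.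
  rewrite (divdiff_powser a ck) (entire_mx_powser _ dk) mxE.
  by apply: eq_csum => n; rewrite exprNZ mxE.
have yt : geom_le (fun n => t%:C ^+ n * y n) 1 (`|t| * smx (- H)).
  move=> n; rewrite Normc.normcM normcX normc_real exprMn mul1r.
  rewrite ler_wpM2l ?exprn_ge0//.
  by have := geom_le_mx (- H) ord_max ord0 n; rewrite mul1r.
have t0 : 0 <= `|t| * smx (- H) by rewrite mulr_ge0 ?smx_ge0.
rewrite (csum_ddcoef_rearrange a t0 ck yt); apply/esym/cvg_limnC.
have hy : geom_le (horner_seq a (fun n => t%:C ^+ n * y n)) 1
   (`|t| * smx (- H) + normc a + 1) by exact: geom_le_horner_seq.
rewrite -cvg_shiftS.
rewrite (_ : (fun n => _) = fun n => t%:C * series (fun n => ((n.+1)`!%:R)^-1 *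
   horner_seq a (fun n => t%:C ^+ n * y n) n.+1) n).
  apply: cvgM; first exact: cvg_cst.
  have fS : fact_le (fun n => ((n.+1)`!%:R)^-1 : C) 1 0.
    move=> n; apply: le_trans (ck n.+1) _; rewrite !addn0 !mul1r.
    by rewrite lef_pV2 ?posrE ?ltr0n ?fact_gt0// ler_nat factS leq_pmull.
  exact: (cvg_csum fS (geom_leS hy)).
apply/funext => n; rewrite /series/= big_nat_recl// mul0r mulr0 add0r mulr_sumr.
apply: eq_bigr => k _.
have aE : a = t%:C * - z 0%N by rewrite mulrN.
rewrite -(horner_seqS a (fun n => t%:C ^+ n * y n) k) aE horner_seqZ exprS -/gam; ring.
Qed.

Lemma err2_coef_growth i : geometric_growth (fun n => err2_coef n i 0).
Proof.
rewrite (_ : (fun n => _) = fun n =>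
   ((1%:M *m (- A) ^+ n *m v) i 0 + - b%:C * (V *m (- H) ^+ n *m e1) i 0)
   + ((b * h)%:C * w i 0) * gam n); last first.
  apply/funext => n; rewrite /err2_coef !mxE mul1mx mulNr.
  by congr (_ + _); rewrite mulrAC.
apply: geometric_growthD; last exact: geometric_growthZ.
apply: geometric_growthD; last apply: geometric_growthZ.
  by apply: geometric_growth_mulmx => *; exact: geometric_growth_mx.
by apply: geometric_growth_mulmx => *; exact: geometric_growth_mx.
Qed.

Lemma err2_funE (t : R) : err2_fun t =
  arnoldi_err A v V H t + ((t * b * h)%:C * phi_entry H z t 1) *: w.
Proof.
have gA i : geometric_growth (fun n => (1%:M *m (- A) ^+ n *m v) i 0).
  by apply: geometric_growth_mulmx => *; exact: geometric_growth_mx.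
have gH i : geometric_growth (fun n => (V *m (- H) ^+ n *m e1) i 0).
  by apply: geometric_growth_mulmx => *; exact: geometric_growth_mx.
apply/matrixP => i j; rewrite (ord1 j) mxE.
rewrite (_ : (fun n => _) = fun n =>
   ((1%:M *m (- A) ^+ n *m v) i 0 + - b%:C * (V *m (- H) ^+ n *m e1) i 0)
   + ((b * h)%:C * w i 0) * gam n); last first.
  apply/funext => n; rewrite /err2_coef !mxE mul1mx mulNr.
  by congr (_ + _); rewrite mulrAC.
rewrite egfD; last first.
- exact: geometric_growthZ.
- by apply: geometric_growthD => //; exact: geometric_growthZ.
rewrite egfD//; last exact: geometric_growthZ.
rewrite !egfZ// -phi1_egf.
rewrite (egf_mulmx 1%:M v) => [|*]; last exact: geometric_growth_mx.
rewrite (egf_mulmx V e1) => [|*]; last exact: geometric_growth_mx.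
rewrite -!expmx_egf mul1mx /arnoldi_err.
rewrite !mxE mulNr; congr (_ + _).
have -> : (t * b * h)%:C = (b * h)%:C * t%:C by rewrite -rmorphM; congr (_%:C); ring.
ring.
Qed.

Lemma is_derive_Re_err2 (t : R) i :
  is_derive t (1 : R) (fun t => Re (err2_fun t i 0)) (Re (err2_deriv t i 0)).
Proof.
have -> : (fun t => Re (err2_fun t i 0)) =
    fun t => Re (egf (fun n => err2_coef n i 0) t).
  by apply/funext => s; rewrite mxE.
rewrite /err2_deriv mxE; apply: is_derive_Re_egf; exact: err2_coef_growth.
Qed.

Lemma is_derive_Im_err2 (t : R) i :
  is_derive t (1 : R) (fun t => Im (err2_fun t i 0)) (Im (err2_deriv t i 0)).
Proof.
have -> : (fun t => Im (err2_fun t i 0)) =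
    fun t => Im (egf (fun n => err2_coef n i 0) t).
  by apply/funext => s; rewrite mxE.
rewrite /err2_deriv mxE; apply: is_derive_Im_egf; exact: err2_coef_growth.
Qed.

(** The Arnoldi relation produces b h y_n w on the right, and the recurrence of [gam] produces the
    same vector on the left. Adding the first term of the expansion thus removes y from the forcing,
    which keeps only the coefficients of t phi_1. *)
Lemma err2_coefS n : err2_coef n.+1 =
  - A *m err2_coef n + ((b * h)%:C * gam n) *: (q_mx A z 1 *m w).
Proof.
have yE : w *m delta_mx 0 ord_max *m (- H) ^+ n *m e1 = y n *: w.
  have -> : y n *: w = w *m (y n)%:M by rewrite mul_mx_scalar.
  have -> : (y n)%:M = (delta_mx 0 ord_max : 'rV[C]_m.+1) *m (- H) ^+ n *m e1.
    apply/matrixP => i j.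
    by rewrite (ord1 i) (ord1 j) -rowE -colE [LHS]mxE mulr1n [RHS]mxE [RHS]mxE.
  by rewrite !mulmxA.
have AV : - A *m (V *m (- H) ^+ n *m e1) =
    V *m (- H) ^+ n.+1 *m e1 - (h%:C * y n) *: w.
  rewrite !mulmxA mulNmx (arnoldi_rel arn) opprD mulmxDl mulmxDl -mulmxN.
  rewrite exprS -[(- H * _)%R]/(- H *m _) !mulmxA; congr (_ + _).
  by rewrite mulNmx mulNmx -!scalemxAl yE scalerA.
have -> : q_mx A z 1 = A - (z 0%N)%:M by rewrite /q_mx big_ord_recl big_ord0 mulr1.
rewrite /err2_coef mulmxDr mulmxBr -!scalemxAr AV.
rewrite mulmxA -[- A *m (- A) ^+ n]/(- A * (- A) ^+ n) -exprS.
rewrite -[gam n.+1]/(- z 0%N * gam n + y n).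
rewrite mulmxBl mul_scalar_mx mulNmx.
move: (_ *m v) (V *m _ *m e1) (gam n) (y n) (A *m w) => p q g y' r.
rewrite !scalerBr !scalerN !scalerA [in RHS]mulrA -rmorphM /=.
have -> : (b * h)%:C * (- z 0%N * g + y') =
    - ((b * h)%:C * g * z 0%N) + (b * h)%:C * y' by ring.
rewrite scalerDl scaleNr.
move: (_ *: q) (_ *: w) (_ *: w) (_ *: r) => a1 a2 a3 a4.
rewrite opprB -!addrA; congr (_ + _).
by rewrite addKr addrC [RHS]addrA addrAC (addrC a3).
Qed.

Lemma err2_deriveE (t : R) : err2_deriv t =
  - A *m err2_fun t + ((b * h * t)%:C * phi_entry H z t 1) *: (q_mx A z 1 *m w).
Proof.
set u := q_mx A z 1 *m w.
have gA i : geometric_growth (fun n => (- A *m err2_coef n *m 1%:M) i 0).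
  apply: geometric_growth_mulmx => k j; rewrite (ord1 j); exact: err2_coef_growth.
apply/matrixP => i j; rewrite (ord1 j) mxE.
rewrite (_ : (fun n => _) = fun n =>
   (- A *m err2_coef n *m 1%:M) i 0 + ((b * h)%:C * u i 0) * gam n); last first.
  by apply/funext => n; rewrite err2_coefS mulmx1 !mxE mulrAC.
rewrite egfD//; last exact: geometric_growthZ.
rewrite egfZ// egf_mulmx => [|k l]; last by rewrite (ord1 l); exact: err2_coef_growth.
have -> : \matrix_(k, l) egf (fun n => err2_coef n k l) t = err2_fun t.
  by apply/matrixP => k l; rewrite !mxE (ord1 l).
rewrite mulmx1 -phi1_egf [in RHS]mxE; congr (_ + _).
have -> : (b * h * t)%:C = (b * h)%:C * t%:C by rewrite -rmorphM.
rewrite [RHS]mxE; ring.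
Qed.

Lemma err2_fun0 : err2_fun 0 = 0.
Proof.
apply/matrixP => i j; rewrite mxE egf0; last exact: err2_coef_growth.
rewrite /err2_coef !expr0 mul1mx mulmx1 (arnoldi_start arn vn0) subrr add0r.
by rewrite mulr0 scale0r !mxE.
Qed.

End ErrorEquation.

(** * Logarithmic norm and Gronwall's inequality *)

Section EuclideanNorm.
Context {R : realType}.
Local Notation C := R[i].
Implicit Types (N : nat).

(** The real part of the Hermitian product, that is, the Euclidean product of C^N seen as R^(2N);
    half the derivative of |F|^2 is [rdot F dF]. *)
Definition rdot N (x y : 'cV[C]_N) : R :=
  \sum_i (Re (x i 0) * Re (y i 0) + Im (x i 0) * Im (y i 0)).

Lemma rdotC N (x y : 'cV[C]_N) : rdot x y = rdot y x.
Proof. by apply: eq_bigr => i _; rewrite mulrC [X in _ + X]mulrC. Qed.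

Lemma rdotDr N (x y y' : 'cV[C]_N) : rdot x (y + y') = rdot x y + rdot x y'.
Proof.
rewrite /rdot -big_split; apply: eq_bigr => i _; rewrite mxE ReD ImD /=; ring.
Qed.

Lemma rdotDl N (x x' y : 'cV[C]_N) : rdot (x + x') y = rdot x y + rdot x' y.
Proof. by rewrite !(rdotC _ y) rdotDr. Qed.

Lemma rdotZr N (a : R) (x y : 'cV[C]_N) : rdot x (a%:C *: y) = a * rdot x y.
Proof.
rewrite /rdot mulr_sumr; apply: eq_bigr => i _; rewrite mxE.
case: (y i 0) => p q /=; rewrite !mul0r subr0 addr0; ring.
Qed.

Lemma rdotZl N (a : R) (x y : 'cV[C]_N) : rdot (a%:C *: x) y = a * rdot x y.
Proof. by rewrite rdotC rdotZr rdotC. Qed.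

Lemma enorm_ge0 N (x : 'cV[C]_N) : 0 <= enorm x.
Proof. exact: sqrtr_ge0. Qed.

Lemma rdotxx N (x : 'cV[C]_N) : rdot x x = enorm x ^+ 2.
Proof.
rewrite /enorm sqr_sqrtr; last by apply: sumr_ge0 => i _; exact: sqr_ge0.
apply: eq_bigr => i _; case: (x i 0) => a b /=.
by rewrite sqr_sqrtr ?addr_ge0 ?sqr_ge0// !expr2.
Qed.

Lemma rdot0l N (x : 'cV[C]_N) : rdot 0 x = 0.
Proof. by rewrite -[0](scale0r x) rdotZl mul0r. Qed.

Lemma cauchy_schwarz N (x y : 'cV[C]_N) : rdot x y <= enorm x * enorm y.
Proof.
have [->|x0] := eqVneq x 0; first by rewrite rdot0l mulr_ge0 ?enorm_ge0.
have [->|y0] := eqVneq y 0; first by rewrite rdotC rdot0l mulr_ge0 ?enorm_ge0.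
have xp : 0 < enorm x by rewrite lt0r enorm_eq0 x0 enorm_ge0.
have yp : 0 < enorm y by rewrite lt0r enorm_eq0 y0 enorm_ge0.
set a := enorm x in xp *; set b := enorm y in yp *.
(* The square of the norm of |y| x - |x| y expands to 2 |x| |y| (|x| |y| - rdot x y). *)
have : 0 <= rdot (b%:C *: x + (- a)%:C *: y) (b%:C *: x + (- a)%:C *: y).
  by rewrite rdotxx sqr_ge0.
rewrite rdotDl !rdotDr !rdotZl !rdotZr !rdotxx (rdotC y x) -/a -/b => h.
rewrite -(ler_pM2l (mulr_gt0 xp yp)); nra.
Qed.

Lemma enormD N (x y : 'cV[C]_N) : enorm (x + y) <= enorm x + enorm y.
Proof.
have h : 0 <= enorm x + enorm y by rewrite addr_ge0 ?enorm_ge0.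
rewrite -(@ler_pXn2r _ 2) ?nnegrE ?enorm_ge0// -rdotxx rdotDl !rdotDr !rdotxx.
have := cauchy_schwarz x y; rewrite (rdotC y x) => k; nra.
Qed.

Lemma enormZ N (a : C) (x : 'cV[C]_N) : enorm (a *: x) = normc a * enorm x.
Proof.
have -> : normc a = Num.sqrt (normc a ^+ 2) by rewrite sqrtr_sqr ger0_norm ?normc_ge0.
rewrite /enorm -sqrtrM ?sqr_ge0// mulr_sumr; congr (Num.sqrt _).
by apply: eq_bigr => i _; rewrite mxE Normc.normcM exprMn.
Qed.

Lemma enorm_le_smx N (x : 'cV[C]_N) : enorm x <= smx x.
Proof.
rewrite -(@ler_pXn2r _ 2) ?nnegrE ?enorm_ge0 ?smx_ge0//.
rewrite /enorm sqr_sqrtr; last by apply: sumr_ge0 => i _; exact: sqr_ge0.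
rewrite expr2 {1}/smx mulr_suml; apply: ler_sum => i _.
by rewrite big_ord1 expr2 ler_wpM2l ?normc_ge0//; exact: normc_le_smx.
Qed.

Lemma normc_le_enorm N (x : 'cV[C]_N) i : normc (x i 0) <= enorm x.
Proof.
rewrite -(@ler_pXn2r _ 2) ?nnegrE ?enorm_ge0 ?normc_ge0//.
rewrite /enorm sqr_sqrtr; last by apply: sumr_ge0 => *; exact: sqr_ge0.
by rewrite (bigD1 i)//= lerDl; apply: sumr_ge0 => *; exact: sqr_ge0.
Qed.

Lemma smx_le_enorm N (x : 'cV[C]_N) : smx x <= N%:R * enorm x.
Proof.
rewrite /smx mulr_natl -[X in _ *+ X]card_ord -sumr_const.
by apply: ler_sum => i _; rewrite big_ord1 normc_le_enorm.
Qed.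

End EuclideanNorm.

(** * The logarithmic norm as a bound on Re <x, B x> *)

Section LogarithmicNorm.
Context {R : realType} {N : nat}.
Local Notation C := R[i].
Implicit Types (B : 'M[C]_N) (x : 'cV[C]_N).

Lemma enorm_le_opnorm2 B x : enorm x = 1 -> enorm (B *m x) <= opnorm2 B.
Proof.
move=> x1; apply: ub_le_sup; last by exists x.
exists (smx B * N%:R) => _ [y /= y1 <-].
apply: le_trans (enorm_le_smx _) _; apply: le_trans (smxM _ _) _.
by rewrite ler_wpM2l ?smx_ge0// (le_trans (smx_le_enorm _))// y1 mulr1.
Qed.

(** The unit vector [x0] makes the set under [sup] nonempty; in dimension 0 the supremum would be a
    default value. *)
Lemma opnorm2_le B x0 (M : R) : enorm x0 = 1 ->
  (forall x, enorm x = 1 -> enorm (B *m x) <= M) -> opnorm2 B <= M.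
Proof.
move=> x01 BM; apply: ge_sup; first by exists (enorm (B *m x0)), x0.
by move=> _ [x x1 <-]; exact: BM.
Qed.

Let quot B (s : R) : R := (opnorm2 (1%:M + s%:C *: B) - 1) / s.

(** For a unit x, 1 + s Re <x, B x> = Re <x, (I + s B) x> is at most the norm of I + s B. *)
Let quot_ge B (s : R) x : 0 < s -> enorm x = 1 -> rdot x (B *m x) <= quot B s.
Proof.
move=> s0 x1; rewrite ler_pdivlMr// lerBrDl mulrC.
apply: le_trans (enorm_le_opnorm2 _ x1).
rewrite -[leRHS]mul1r -x1; apply: le_trans (cauchy_schwarz _ _).
by rewrite mulmxDl mul1mx rdotDr rdotxx -scalemxAl rdotZr x1 expr1n.
Qed.

(* Convexity of the norm: I + s B is a convex combination of I and I + t B.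
   With the lower bound [quot_ge], this gives the existence of the limit. *)
Let quot_nondecreasing B x0 : enorm x0 = 1 ->
  {in `]0, +oo[ &, nondecreasing_fun (quot B)}.
Proof.
move=> x01 s t; rewrite !in_itv/= !andbT => s0 t0 st.
rewrite /quot ler_pdivrMr// mulrAC ler_pdivlMr//.
have st0 : 0 <= 1 - s / t by rewrite subr_ge0 ler_pdivrMr// mul1r.
suff : opnorm2 (1%:M + s%:C *: B) <=
    (1 - s / t) + s / t * opnorm2 (1%:M + t%:C *: B).
  move: (opnorm2 _) (opnorm2 _) => Q P; rewrite -(ler_pM2r t0).
  have -> : ((1 - s / t) + s / t * Q) * t = t - s + s * Q.
    by field; rewrite gt_eqF.
  lra.
apply: opnorm2_le x01 _ => x x1.
have -> : (1%:M + s%:C *: B) *m x = (1 - s / t)%:C *: x +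
    (s / t)%:C *: ((1%:M + t%:C *: B) *m x).
  rewrite !mulmxDl !mul1mx scalerDr addrA -scalerDl -rmorphD subrK scale1r.
  by rewrite -!scalemxAl scalerA -rmorphM /= divfK ?gt_eqF.
apply: le_trans (enormD _ _) _; rewrite !enormZ !normc_real x1 mulr1.
have st1 : 0 <= s / t by rewrite divr_ge0 ?(ltW s0) ?(ltW t0).
by rewrite (ger0_norm st0) (ger0_norm st1) lerD2l ler_wpM2l// enorm_le_opnorm2.
Qed.

(** The quotient is nondecreasing and bounded below, so its limit at 0+ is its infimum and inherits
    the lower bound [quot_ge]. Normalizing x supplies the unit vector that monotonicity asks for. *)
Lemma rdot_le_lognorm2 B x : rdot x (B *m x) <= lognorm2 B * enorm x ^+ 2.
Proof.
have [->|x0] := eqVneq x 0.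
  have -> : enorm (0 : 'cV[C]_N) = 0 by apply/eqP; rewrite enorm_eq0.
  by rewrite rdot0l expr0n mulr0.
suff unit_le y : enorm y = 1 -> rdot y (B *m y) <= lognorm2 B.
  have xp : 0 < enorm x by rewrite lt0r enorm_eq0 x0 enorm_ge0.
  have := unit_le ((enorm x)^-1%:C *: x).
  rewrite enormZ normc_real ger0_norm ?invr_ge0 ?enorm_ge0// mulVf ?gt_eqF//.
  move=> /(_ erefl); rewrite -scalemxAr rdotZl rdotZr mulrA -expr2 mulrC.
  by rewrite exprVn ler_pdivrMr// exprn_gt0.
move=> y1.
have lb : forall r, (quot B @` [set` `]0, +oo[]) r -> rdot y (B *m y) <= r.
  by move=> r [s /=]; rewrite in_itv/= andbT => s0 <-; exact: quot_ge.
have cq : quot B s @[s --> 0^'+] --> inf (quot B @` [set` `]0, +oo[]).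
  apply: nondecreasing_at_right_cvgr => //; first exact: quot_nondecreasing y1.
  by exists (rdot y (B *m y)).
rewrite /lognorm2 (cvg_lim _ cq)//; apply: lb_le_inf => //.
by exists (quot B 1), 1 => //=; rewrite in_itv/= ltr01.
Qed.

End LogarithmicNorm.

(** * Gronwall's inequality for curves in C^N *)

Section Gronwall.
Context {R : realType} {N : nat}.
Local Notation C := R[i].
Variables (F dF : R -> 'cV[C]_N) (mu K tau : R).
Hypothesis dRe : forall t i,
  is_derive t (1 : R) (fun t => Re (F t i 0)) (Re (dF t i 0)).
Hypothesis dIm : forall t i,
  is_derive t (1 : R) (fun t => Im (F t i 0)) (Im (dF t i 0)).
Hypothesis F0 : F 0 = 0.
Hypothesis tau_gt0 : 0 < tau.
Hypothesis K_ge0 : 0 <= K.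
Hypothesis growth : forall t, 0 <= t <= tau ->
  rdot (F t) (dF t) <= mu * enorm (F t) ^+ 2 + K * enorm (F t).

Let is_derive_rdot t :
  is_derive t (1 : R) (fun t => rdot (F t) (F t)) (2 * rdot (F t) (dF t)).
Proof.
pose f i := (fun t => Re (F t i 0)) * (fun t => Re (F t i 0))
            + (fun t => Im (F t i 0)) * (fun t => Im (F t i 0)) : R -> R.
have -> : (fun t => rdot (F t) (F t)) = \sum_(i < N) f i.
  by apply/funext => s; rewrite fct_sumE.
have := is_derive_sum (fun i => is_deriveD (is_deriveM (dRe t i) (dRe t i))
  (is_deriveM (dIm t i) (dIm t i))).
move/is_derive_eq; apply; rewrite /rdot mulr_sumr; apply: eq_bigr => i _.
rewrite /GRing.scale/=; ring.
Qed.

(** The integral of e^(- mu s) for s from 0 to t. *)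
Let Theta t := if mu == 0 then t else (1 - expR (- mu * t)) / mu.

Let is_derive_exp t :
  is_derive t (1 : R) (fun t => expR (- mu * t)) (- mu * expR (- mu * t)).
Proof.
have h : is_derive t (1 : R) (fun t => - mu * t) (- mu).
  have := is_deriveZ (- mu) (is_derive_id t (1 : R)).
  by move/is_derive_eq; apply; rewrite /GRing.scale/= mulr1.
have := is_derive1_comp (is_derive_expR (- mu * t)) h.
by move/is_derive_eq; apply; rewrite mulrC.
Qed.

Let is_derive_Theta t : is_derive t (1 : R) Theta (expR (- mu * t)).
Proof.
rewrite /Theta; have [mu0|mu0] := eqVneq mu 0.
  by rewrite mu0 oppr0 mul0r expR0; exact: is_derive_id.
have -> : (fun t => (1 - expR (- mu * t)) / mu) =
   mu^-1 *: (cst 1 - (fun t => expR (- mu * t))).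
  by apply/funext => s; rewrite mulrC.
have := is_deriveZ mu^-1 (is_deriveB (is_derive_cst (1 : R) t (1 : R)) (is_derive_exp t)).
by move/is_derive_eq; apply; rewrite /GRing.scale/= sub0r mulNr opprK mulKf.
Qed.

(* The square root is smoothed by e to keep it differentiable where F = 0. *)
Let smoothed (e : R) : 0 < e ->
  enorm (F tau) <= expR (mu * tau) * (e + (K + `|mu| * e) * Theta tau).
Proof.
move=> e0; pose u t := Num.sqrt (rdot (F t) (F t) + e ^+ 2).
have up t : 0 < rdot (F t) (F t) + e ^+ 2.
  by rewrite rdotxx ltr_wpDl ?sqr_ge0 ?exprn_gt0.
have u2 t : u t ^+ 2 = enorm (F t) ^+ 2 + e ^+ 2.
  by rewrite /u sqr_sqrtr ?(ltW (up t))// rdotxx.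
have u0 t : 0 < u t by rewrite sqrtr_gt0.
have eu t : e <= u t.
  by rewrite -(@ler_pXn2r _ 2) ?nnegrE ?(ltW e0) ?(ltW (u0 t))// u2 lerDr sqr_ge0.
have Fu t : enorm (F t) <= u t.
  rewrite -(@ler_pXn2r _ 2) ?nnegrE ?enorm_ge0 ?(ltW (u0 t))//.
  by rewrite u2 lerDl sqr_ge0.
have du t : is_derive t (1 : R) u (rdot (F t) (dF t) / u t).
  have h := is_deriveD (is_derive_rdot t) (is_derive_cst (e ^+ 2) t (1 : R)).
  have := @is_derive1_comp _ Num.sqrt (fun t => rdot (F t) (F t) + e ^+ 2) t _ _
    (is_derive1_sqrt (up t)) h.
  move/is_derive_eq; apply; rewrite -/(u t) addr0 invfM; field.
  by rewrite gt_eqF.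
(* Writing |F|^2 = u^2 - e^2 in the growth bound leaves - mu e^2, which is at most |mu| e u because
   e <= u. Hence u' <= mu u + K', and [G] does not increase on [0, tau]. *)
pose K' := K + `|mu| * e.
pose G := (fun t => expR (- mu * t)) * u - K' *: Theta : R -> R.
pose dG t := expR (- mu * t) * (rdot (F t) (dF t) / u t - mu * u t - K').
have dGE t : is_derive t (1 : R) G (dG t).
  have := is_deriveB (is_deriveM (is_derive_exp t) (du t))
    (is_deriveZ K' (is_derive_Theta t)).
  move/is_derive_eq; apply; rewrite /GRing.scale/= /dG; ring.
have dG_le t : 0 <= t <= tau -> dG t <= 0.
  move=> /growth h; rewrite pmulr_rle0 ?expR_gt0//.
  rewrite -addrA -opprD subr_le0 ler_pdivrMr//.
  have := u2 t; have := eu t; have := Fu t; have := u0 t.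
  have mu1 : - mu <= `|mu| by rewrite -normrN ler_norm.
  have mu2 : 0 <= `|mu| by [].
  move=> a1 a2 a3 a4; apply: le_trans h _.
  have -> : enorm (F t) ^+ 2 = u t ^+ 2 - e ^+ 2 by rewrite a4 addrK.
  have b1 : K * enorm (F t) <= K * u t by rewrite ler_wpM2l.
  have b2 : - mu * e ^+ 2 <= `|mu| * e ^+ 2 by rewrite ler_wpM2r ?sqr_ge0.
  have b3 : `|mu| * e ^+ 2 <= `|mu| * e * u t.
    by rewrite expr2 mulrA ler_wpM2l ?mulr_ge0 ?(ltW e0).
  rewrite /K'; nra.
have [c] := @MVT_segment _ G dG 0 tau (ltW tau_gt0) (fun t _ => dGE t)
  (derivable_within_continuous (fun t _ => @ex_derive _ _ _ _ _ _ _ (dGE t))).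
rewrite in_itv/= subr0 => /dG_le cG GE.
have : G tau <= G 0 by rewrite -subr_le0 GE pmulr_lle0.
have -> : G 0 = e.
  rewrite /G !fctE /GRing.scale/= /Theta mulr0 expR0 subrr mul0r if_same mulr0.
  rewrite subr0 mul1r /u F0 rdotxx.
  have -> : enorm (0 : 'cV[C]_N) = 0 by apply/eqP; rewrite enorm_eq0.
  by rewrite expr0n add0r sqrtr_sqr gtr0_norm.
rewrite /G !fctE /GRing.scale/= lerBlDr => h.
apply: le_trans (Fu tau) _; rewrite -(ler_pM2l (expR_gt0 (- mu * tau))) mulrA.
by rewrite -expRD mulNr addNr expR0 mul1r -mulNr.
Qed.

Lemma gronwall : enorm (F tau) <=
  K * (if mu == 0 then tau else (expR (tau * mu) - 1) / mu).
Proof.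
have T0 : 0 <= Theta tau.
  rewrite /Theta; have [mu0|mu0] := eqVneq mu 0; first exact: ltW.
  have [mup|mun] := ltP 0 mu.
    apply: divr_ge0; last exact: ltW.
    rewrite subr_ge0 expR_le1 mulNr oppr_le0.
    by rewrite mulr_ge0 ?(ltW mup) ?(ltW tau_gt0).
  rewrite -mulrNN mulr_ge0//.
    rewrite opprB subr_ge0 -expR0 ler_expR mulNr oppr_ge0.
    by rewrite mulr_le0_ge0// ltW.
  by rewrite oppr_ge0 invr_le0.
have -> : (if mu == 0 then tau else (expR (tau * mu) - 1) / mu) =
    expR (mu * tau) * Theta tau.
  rewrite /Theta; have [->|mu0] := eqVneq mu 0; first by rewrite mul0r expR0 mul1r.
  by rewrite mulrA mulrBr mulr1 -expRD mulNr addrN expR0 (mulrC tau).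
apply/ler_addgt0Pr => eps eps0.
(* [c] is the coefficient of e in the smoothed bound. The choice e = eps / (c + 1) has a positive
   denominator and gives e c <= eps. *)
pose c := expR (mu * tau) * (1 + `|mu| * Theta tau).
have c0 : 0 <= c.
  by rewrite mulr_ge0 ?expR_ge0// addr_ge0// mulr_ge0.
have e0 : 0 < eps / (c + 1) by rewrite divr_gt0// ltr_wpDl.
apply: le_trans (smoothed e0) _; set e := _ / _ in e0 *.
have -> : expR (mu * tau) * (e + (K + `|mu| * e) * Theta tau) =
  K * (expR (mu * tau) * Theta tau) + e * c by rewrite /c; ring.
rewrite lerD2l /e mulrAC ler_pdivrMr ?ltr_wpDl// ler_wpM2l ?(ltW eps0)//.
by rewrite lerDl.
Qed.

End Gronwall.

(** * Error bounds *)

(** Supplies the uniform bound on the nodes for the convergence of the Newton expansion. Each factor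
    N comes from smx x <= N |x| with |x| = 1. *)
Lemma fov_bounded (R : realType) N (A : 'M[R[i]]_N) (a : R[i]) :
  fov A a -> normc a <= N%:R * smx A * N%:R.
Proof.
move=> [x [x1 ->]].
have ex : enorm x = 1.
  have : (x ^t* *m x) 0 0 = 1 by rewrite x1 mxE.
  rewrite mxE => h; have : (enorm x ^+ 2)%:C = (1 : R[i]).
    rewrite -h /enorm sqr_sqrtr; last by apply: sumr_ge0 => *; exact: sqr_ge0.
    rewrite rmorph_sum; apply: eq_bigr => i _ /=.
    by rewrite rmorphXn /= normc_normr normCK !mxE mulrC.
  move=> /complexI/eqP; rewrite sqrp_eq1 ?enorm_ge0// => /eqP//.
have xs : smx x <= N%:R by rewrite (le_trans (smx_le_enorm x))// ex mulr1.
have xt : smx (x ^t*) = smx x.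
  rewrite /smx exchange_big; apply: eq_bigr => i _; apply: eq_bigr => j _.
  rewrite !mxE; apply: complexI; rewrite !normc_normr; exact: norm_conjC.
apply: le_trans (normc_le_smx _ 0 0) _; apply: le_trans (smxM _ _) _.
apply: ler_pM; rewrite ?smx_ge0//; apply: le_trans (smxM _ _) _.
by rewrite ler_wpM2r ?smx_ge0// xt.
Qed.

Lemma phi_entry1_le_max (R : realType) m (H : 'M[R[i]]_m.+1) (z : nat -> R[i])
    (r tau t : R) : (forall i, normc (z i) <= r) -> 0 <= t <= tau ->
  normc (phi_entry H z t 1) <= max_phi1 H z tau.
Proof.
move=> zr ttau; have r0 : 0 <= r by exact: le_trans (normc_ge0 _) (zr 0%N).
apply: ub_le_sup; last by exists t => //=; rewrite in_itv.
(* An upper bound is required for [sup] to dominate its members: e^(tau r) is the cost of the one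
   divided difference in phi_1, the other factor bounds the series in - s H. *)
exists (expR (tau * r) * expR (tau * smx H)) => _ [s + <-] /=.
rewrite set_itvcc /= => /andP[s0 stau].
have szr i : normc (s%:C * z i) <= tau * r.
  by rewrite Normc.normcM normc_real ger0_norm// ler_pM// normc_ge0.
rewrite (phi_entryE H 1 szr) mxE.
have := csum_le (fact_leW (fact_le_phicoef 1 szr))
  (geom_le_mx (- (s%:C *: H)) ord_max ord0).
rewrite expr1 (_ : 1`! = 1)%N// divr1 mulr1 => /le_trans; apply.
rewrite ler_wpM2l ?expR_ge0// ler_expR smxN smxZ normc_real ger0_norm//.
by rewrite ler_wpM2r ?smx_ge0.
Qed.

Theorem theorem4p3 (R : realType) (N m : nat) (A : 'M[R[i]]_N)
    (v : 'cV[R[i]]_N) (tau : R)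
    (V : 'M[R[i]]_(N, m.+1)) (H : 'M[R[i]]_m.+1) (h : R) (w : 'cV[R[i]]_N)
    (z : nat -> R[i]) :
  v != 0 -> 0 < tau ->
  arnoldi A v V H h w ->
  (forall i, fov A (z i)) -> contiguous z ->
  enorm (arnoldi_err2 A v H h w z tau)
    <= gamma2 A w z tau * (tau * enorm v * h) * max_phi1 H z tau /\
  enorm (arnoldi_err A v V H tau)
    <= (1 + gamma2 A w z tau) * (tau * enorm v * h) * max_phi1 H z tau.
Proof.
move=> v0 tau0 arn zA _.
set r := N%:R * smx A * N%:R.
have zr i : normc (z i) <= r by exact: fov_bounded.
have h0 := arnoldi_next_pos arn.
have b0 := enorm_ge0 v.
have phiM t : 0 <= t <= tau -> normc (phi_entry H z t 1) <= max_phi1 H z tau.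
  exact: phi_entry1_le_max.
have tt : 0 <= tau <= tau by rewrite ltW/=.
have M0 : 0 <= max_phi1 H z tau := le_trans (normc_ge0 _) (phiM _ tt).
set M := max_phi1 H z tau in phiM M0 *.
have E2 := arnoldi_err2E arn v0 zr tau0.
have FE := err2_funE A v V H h w z tau.
set F := err2_fun A v V H h w z in FE.
pose q := enorm (q_mx A z 1 *m w); have q0 : 0 <= q := enorm_ge0 _.
have F_le : enorm (F tau) <= gamma2 A w z tau * (tau * enorm v * h) * M.
  (* The forcing b h t phi_1(t) q_1(A) w is bounded uniformly on [0, tau] by t <= tau and |phi_1(t)|
     <= M; this is the constant of Gronwall's inequality and the origin of the factor tau. *)
  have K0 : 0 <= tau * enorm v * h * M * q.
    by rewrite !mulr_ge0 ?(ltW tau0) ?(ltW h0).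
  apply: le_trans (gronwall (dF := err2_deriv A v V H h w z)
     (mu := lognorm2 (- A)) _ _ _ tau0 K0 _) _.
  - by move=> t i; exact: is_derive_Re_err2.
  - by move=> t i; exact: is_derive_Im_err2.
  - exact: err2_fun0.
  - move=> t /[dup] tt' /andP[t0 ttau]; rewrite (err2_deriveE _ arn) rdotDr.
    apply: lerD; first exact: rdot_le_lognorm2.
    apply: le_trans (cauchy_schwarz _ _) _.
    rewrite mulrC ler_wpM2r ?enorm_ge0// enormZ -/q ler_wpM2r//.
    rewrite Normc.normcM normc_real ger0_norm ?mulr_ge0// ?(ltW h0)//.
    apply: ler_pM; rewrite ?normc_ge0 ?mulr_ge0 ?(ltW h0)//; last exact: phiM.
    by rewrite mulrC mulrA ler_wpM2r ?(ltW h0)// ler_wpM2r.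
  rewrite /gamma2 -/q le_eqVlt; apply/orP; left; apply/eqP.
  by case: ifP => _; ring.
split; first by rewrite E2 -FE.
(* Since |w| = 1, restoring the first term of the expansion costs tau b h M, the 1 in 1 +
   gamma_2. *)
have -> : arnoldi_err A v V H tau =
    F tau + - ((tau * enorm v * h)%:C * phi_entry H z tau 1) *: w.
  by rewrite FE scaleNr addrK.
apply: le_trans (enormD _ _) _; rewrite addrC mulrDl mul1r mulrDl.
apply: lerD => //; rewrite enormZ (arnoldi_next_unit arn) mulr1 normcN.
rewrite Normc.normcM normc_real ger0_norm; last first.
  by rewrite !mulr_ge0 ?(ltW tau0) ?(ltW h0).
by rewrite ler_wpM2l ?phiM// !mulr_ge0 ?(ltW tau0) ?(ltW h0).
Qed.
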